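(* Let $G$ be a directed graph and $v$ a vertex of $G$; let $E(v)$ be the set of all edges of $G$ incident at $v$. 1. The following statements are equivalent: (1) there are no directed cycles in $G$ containing $v$; (2) $\mathbb{Z}[E(v)]/\mathrm{ann}_{\mathbb{Z}[E(v)]}(\mathscr H_0(G))$ is a finitely generated $\mathbb{Z}$-module; (3) $\mathbb{Z}[E(v)]/\mathrm{ann}_{\mathbb{Z}[E(v)]}(\mathscr H_*(G))$ is a finitely generated $\mathbb{Z}$-module; (4) there is an $n\ge1$ such that $x^n\in I(G)$ for all $x\in E(v)$; (5) $\mathrm{Kdim}_{\mathbb{Z}[E(v)]}\mathscr H_0(G)=1$; (6) $\mathrm{Kdim}_{\mathbb{Q}[E(v)]}\mathscr H_0^{\mathbb{Q}}(G)=0$. 2. $\alpha_v(G)\le\mathrm{Kdim}_{\mathbb{Q}[E(v)]}\mathscr H_0^{\mathbb{Q}}(G)\le\mathrm{Kdim}_{\mathbb{Z}[E(v)]}\mathscr H_0(G)-1\le\beta_v(G)$.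
   Context: A directed graph $G$: finite sets $V(G)$, $E(G)$, each edge with an initial and a terminal vertex; loops and multiple edges allowed; no vertex of degree $0$. Directed cycles are closed directed paths with pairwise distinct vertices (up to circular permutation). $\alpha_v(G)$ is the maximal number of pairwise edge-disjoint directed cycles each containing $v$; $\beta_v(G)$ is the minimal number of edges incident at $v$ whose removal destroys all directed cycles containing $v$. $\mathbb{Z}[E(G)]$ is graded with every edge of degree $1$. For a vertex $w$ with outgoing edges $x_1,\dots,x_m$ and incoming edges $y_1,\dots,y_n$ (a loop appears in both), $k_w=\max\{m,n\}$, $\delta_{w,l}=e_l(x_1,\dots,x_m)-e_l(y_1,\dots,y_n)$ for $1\le l\le k_w$ ($e_l$ elementary symmetric); $\Delta_G$ is the list of all these and $I(G)$ the ideal of $\mathbb{Z}[E(G)]$ they generate. For homogeneous $r$ in a graded commutative ring $R$, $C^R(r)$ is $0\to R\{\deg r\}\xrightarrow{r}R\to0$ (homological degrees $1,0$; $\{l\}$ shifts grading by $l$) and $C^R(r_1,\dots,r_k)=\bigotimes_R C^R(r_i)$. $\mathscr C_*(G)=C^{\mathbb{Z}[E(G)]}_*(\Delta_G)$ with homology $\mathscr H_*(G)$ and $0$-th homology $\mathscr H_0(G)$; $\mathscr H_0^{\mathbb{Q}}(G)$ is the $0$-th homology of $\mathbb{Q}\otimes_{\mathbb{Z}}\mathscr C_*(G)$. These are regarded as modules over the subrings $\mathbb{Z}[E(v)]$, $\mathbb{Q}[E(v)]$. $\mathrm{ann}_R(M)$ is the annihilator and $\mathrm{Kdim}_R M$ the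 Krull dimension of $R/\mathrm{ann}_R(M)$. *)

(* Defs.v *)
From HB Require Import structures.
From mathcomp Require Import all_boot all_order all_algebra.
(* [mpoly] has to be imported before [constructive_ereal]: their notation
   levels clash in the other order. *)
From mathcomp Require Import mpoly.
From mathcomp Require Import boolp classical_sets constructive_ereal.

Set Implicit Arguments.
Unset Strict Implicit.
Unset Printing Implicit Defensive.

Import Order.TTheory GRing.Theory Num.Theory.

Local Open Scope ring_scope.
Local Open Scope quotient_scope.

Record submodule (R : pzRingType) (M : lmodType R) := Submodule {
  submod_pred :> {pred M};
  submod_predP : submod_closed submod_pred
}.

HB.instance Definition _ (R : pzRingType) (M : lmodType R) (U : submodule M) :=
  GRing.isSubmodClosed.Build R M (submod_pred U) (submod_predP U).

Definition lquot (R : pzRingType) (M : lmodType R) (U : submodule M) : Type :=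
  Quotient.quot (submod_pred U).

Section LmodQuotient.
Variables (R : pzRingType) (M : lmodType R) (U : submodule M).

HB.instance Definition _ :=
  GRing.Zmodule.copy (lquot U) (Quotient.quot (submod_pred U)).

Definition lquot_pi (x : M) : lquot U := \pi_(Quotient.quot (submod_pred U)) x.
Definition lquot_repr (q : lquot U) : M :=
  repr (q : Quotient.quot (submod_pred U)).

Lemma lquot_reprK : cancel lquot_repr lquot_pi.
Proof. by move=> q; rewrite /lquot_pi reprK. Qed.

Lemma lquot_piP (x y : M) : lquot_pi x = lquot_pi y <-> x - y \in U.
Proof.
split=> [e|h]; last by apply/eqP; rewrite -Quotient.idealrBE.
by rewrite Quotient.idealrBE; apply/eqP.
Qed.

Lemma lquot_piD : {morph lquot_pi : x y / x + y}.
Proof. by move=> x y; rewrite /lquot_pi [LHS]raddfD. Qed.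

Definition lquot_scale (a : R) (q : lquot U) : lquot U :=
  lquot_pi (a *: lquot_repr q).

Lemma lquot_pi_scale a (x : M) :
  lquot_scale a (lquot_pi x) = lquot_pi (a *: x).
Proof.
apply/lquot_piP; rewrite -scalerBr; apply: rpredZ.
by apply/lquot_piP; rewrite lquot_reprK.
Qed.

Fact lquot_scaleA a b (q : lquot U) :
  lquot_scale a (lquot_scale b q) = lquot_scale (a * b) q.
Proof. by rewrite -[q]lquot_reprK !lquot_pi_scale scalerA. Qed.

Fact lquot_scale1 : left_id 1 lquot_scale.
Proof. by move=> q; rewrite /lquot_scale scale1r lquot_reprK. Qed.

Fact lquot_scaleDr : right_distributive lquot_scale +%R.
Proof.
move=> a p q; rewrite -[p]lquot_reprK -[q]lquot_reprK.
by rewrite -lquot_piD !lquot_pi_scale -lquot_piD scalerDr.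
Qed.

Fact lquot_scaleDl (q : lquot U) : {morph lquot_scale^~ q : a b / a + b}.
Proof.
by move=> a b; rewrite -[q]lquot_reprK !lquot_pi_scale scalerDl lquot_piD.
Qed.

HB.instance Definition _ := GRing.Zmodule_isLmodule.Build R (lquot U)
  lquot_scaleA lquot_scale1 lquot_scaleDr lquot_scaleDl.

End LmodQuotient.

(* The ideals of A are the submodules of A^o.  Unlike [{ideal_quot I}], this
   does not require the ideal to be proper: R / ann(0) is the zero ring. *)
Definition rquot (A : comPzRingType) (I : submodule A^o) : Type := lquot I.

Section RingQuotient.
Variables (A : comPzRingType) (I : submodule A^o).

HB.instance Definition _ := GRing.Zmodule.copy (rquot I) (lquot I).

Definition rquot_pi (x : A) : rquot I := lquot_pi I x.
Definition rquot_repr (q : rquot I) : A := lquot_repr q.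

Definition rquot_one : rquot I := rquot_pi 1.
Definition rquot_mul (p q : rquot I) : rquot I :=
  rquot_pi (rquot_repr p * rquot_repr q).

Lemma rquot_reprK : cancel rquot_repr rquot_pi.
Proof. exact: lquot_reprK. Qed.

Lemma rquot_piD : {morph rquot_pi : x y / x + y}.
Proof. exact: (@lquot_piD A A^o I). Qed.

Lemma rquot_pi_mul (x y : A) :
  rquot_mul (rquot_pi x) (rquot_pi y) = rquot_pi (x * y).
Proof.
set x' := rquot_repr (rquot_pi x); set y' := rquot_repr (rquot_pi y).
have hx : (x' : A^o) - x \in I by apply/lquot_piP; rewrite [LHS]rquot_reprK.
have hy : (y' : A^o) - y \in I by apply/lquot_piP; rewrite [LHS]rquot_reprK.
apply/lquot_piP; rewrite -/x' -/y'.
have -> : (x' * y' : A^o) - (x * y : A) =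
    x' *: ((y' : A^o) - y) + y *: ((x' : A^o) - x).
  by rewrite /GRing.scale /= !mulrBr addrA [y * x']mulrC [y * x]mulrC subrK.
by apply: rpredD; apply: rpredZ.
Qed.

Fact rquot_mulA : associative rquot_mul.
Proof.
move=> p q r; rewrite -[p]rquot_reprK -[q]rquot_reprK -[r]rquot_reprK.
by rewrite !rquot_pi_mul mulrA.
Qed.

Fact rquot_mulC : commutative rquot_mul.
Proof. by move=> p q; rewrite /rquot_mul mulrC. Qed.

Fact rquot_mul1 : left_id rquot_one rquot_mul.
Proof. by move=> p; rewrite -[p]rquot_reprK rquot_pi_mul mul1r. Qed.

Fact rquot_mulDl : left_distributive rquot_mul +%R.
Proof.
move=> p q r; rewrite -[p]rquot_reprK -[q]rquot_reprK -[r]rquot_reprK.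
by rewrite -rquot_piD !rquot_pi_mul -rquot_piD mulrDl.
Qed.

HB.instance Definition _ := GRing.Zmodule_isComPzRing.Build (rquot I)
  rquot_mulA rquot_mulC rquot_mul1 rquot_mulDl.

End RingQuotient.

Section Annihilator.
Variables (R : comPzRingType) (M : lmodType R).

Definition ann_pred : {pred R^o} := fun a => `[< forall m : M, (a : R) *: m = 0 >].

Fact ann_submod_closed : submod_closed ann_pred.
Proof.
split; first by apply/asboolP => m; rewrite scale0r.
move=> a x y /asboolP hx /asboolP hy; apply/asboolP => m.
by rewrite scalerDl -scalerA hx scaler0 hy addr0.
Qed.

Definition ann : submodule R^o := Submodule ann_submod_closed.

End Annihilator.

Definition restr_scal (S R : pzRingType) (f : {rmorphism S -> R})
  (M : lmodType R) : Type := M.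

Section RestrictionOfScalars.
Variables (S R : pzRingType) (f : {rmorphism S -> R}) (M : lmodType R).

HB.instance Definition _ := GRing.Zmodule.copy (restr_scal f M) M.

Definition restr_scale (a : S) (m : restr_scal f M) : restr_scal f M :=
  f a *: (m : M).

Fact restr_scaleA a b m :
  restr_scale a (restr_scale b m) = restr_scale (a * b) m.
Proof. by rewrite /restr_scale scalerA rmorphM. Qed.

Fact restr_scale1 : left_id 1 restr_scale.
Proof. by move=> m; rewrite /restr_scale rmorph1 scale1r. Qed.

Fact restr_scaleDr : right_distributive restr_scale +%R.
Proof. by move=> a m n; rewrite /restr_scale scalerDr. Qed.

Fact restr_scaleDl m : {morph restr_scale^~ m : a b / a + b}.
Proof. by move=> a b; rewrite /restr_scale rmorphD scalerDl. Qed.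

HB.instance Definition _ := GRing.Zmodule_isLmodule.Build S (restr_scal f M)
  restr_scaleA restr_scale1 restr_scaleDr restr_scaleDl.

End RestrictionOfScalars.

Definition dirsum (R : pzRingType) (I : finType) (M : I -> lmodType R) : Type :=
  {dffun forall i : I, M i}.

Section DirectSum.
Variables (R : pzRingType) (I : finType) (M : I -> lmodType R).
Implicit Types (x y z : dirsum M) (a b : R).

HB.instance Definition _ :=
  Choice.copy (dirsum M) {dffun forall i : I, M i}.

Definition dirsum0 : dirsum M := [ffun i => 0 : M i].
Definition dirsum_opp x : dirsum M := [ffun i => - x i].
Definition dirsum_add x y : dirsum M := [ffun i => x i + y i].
Definition dirsum_scale a x : dirsum M := [ffun i => a *: x i].

Fact dirsum_addA : associative dirsum_add.
Proof. by move=> x y z; apply/ffunP=> i; rewrite !ffunE addrA. Qed.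
Fact dirsum_addC : commutative dirsum_add.
Proof. by move=> x y; apply/ffunP=> i; rewrite !ffunE addrC. Qed.
Fact dirsum_add0 : left_id dirsum0 dirsum_add.
Proof. by move=> x; apply/ffunP=> i; rewrite !ffunE add0r. Qed.
Fact dirsum_addN : left_inverse dirsum0 dirsum_opp dirsum_add.
Proof. by move=> x; apply/ffunP=> i; rewrite !ffunE addNr. Qed.

HB.instance Definition _ := GRing.isZmodule.Build (dirsum M)
  dirsum_addA dirsum_addC dirsum_add0 dirsum_addN.

Fact dirsum_scaleA a b x :
  dirsum_scale a (dirsum_scale b x) = dirsum_scale (a * b) x.
Proof. by apply/ffunP=> i; rewrite !ffunE scalerA. Qed.
Fact dirsum_scale1 : left_id 1 dirsum_scale.
Proof. by move=> x; apply/ffunP=> i; rewrite !ffunE scale1r. Qed.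
Fact dirsum_scaleDr : right_distributive dirsum_scale +%R.
Proof. by move=> a x y; apply/ffunP=> i; rewrite !ffunE scalerDr. Qed.
Fact dirsum_scaleDl x : {morph dirsum_scale^~ x : a b / a + b}.
Proof. by move=> a b; apply/ffunP=> i; rewrite !ffunE scalerDl. Qed.

HB.instance Definition _ := GRing.Zmodule_isLmodule.Build R (dirsum M)
  dirsum_scaleA dirsum_scale1 dirsum_scaleDr dirsum_scaleDl.

End DirectSum.

Definition fg_Zmodule (A : zmodType) : Prop :=
  exists s : seq A, forall a : A,
    exists c : 'I_(size s) -> int, a = \sum_(i < size s) s`_i *~ c i.

Record prime_ideal (A : comPzRingType) (P : set A) : Prop := PrimeIdeal {
  prime_ideal0 : P 0;
  prime_idealD : forall x y, P x -> P y -> P (x + y);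
  prime_idealM : forall a x, P x -> P (a * x);
  prime_ideal_proper : ~ P 1;
  prime_ideal_prime : forall x y, P (x * y) -> P x \/ P y
}.

Definition prime_chain (A : comPzRingType) (n : nat) : Prop :=
  exists P : nat -> set A,
    (forall i, (i <= n)%N -> prime_ideal (P i)) /\
    (forall i, (i < n)%N -> (P i `<` P i.+1)%classic).

(* -oo for the zero ring, +oo if there are arbitrarily long chains. *)
Definition krull_dim (A : comPzRingType) : \bar int :=
  supremum -oo%E [set n%:Z%:E | n in [set n | prime_chain A n]]%classic.

Definition Kdim (R : comPzRingType) (M : lmodType R) : \bar int :=
  krull_dim (rquot (ann M)).

(* A bounded complex of finitely generated free R-modules with chosen bases:
   [hdeg] is the homological degree, [cdmat b c] is the coefficient of the
   basis element c in the differential of the basis element b. *)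
Record complex (R : comPzRingType) := Complex {
  cbasis : finType;
  hdeg : cbasis -> nat;
  cdmat : cbasis -> cbasis -> R;
  cdmat_deg : forall b c, cdmat b c != 0 -> hdeg b = (hdeg c).+1;
  cdmat_sq : forall b c, \sum_x cdmat b x * cdmat x c = 0
}.

Section Homology.
Variables (R : comPzRingType) (C : complex R).

Definition chains : lmodType R := {ffun cbasis C -> R^o}.

Definition cdiff (z : chains) : chains :=
  [ffun c => \sum_b z b * cdmat b c].

Fact cdiff_is_linear : linear cdiff.
Proof.
move=> a x y; apply/ffunP => c; rewrite !ffunE scaler_sumr -big_split /=.
by apply: eq_bigr => b _; rewrite !ffunE mulrDl /GRing.scale /= mulrA.
Qed.

HB.instance Definition _ :=
  GRing.isLinear.Build R chains chains _ cdiff cdiff_is_linear.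

Lemma cdiff_cdiff z : cdiff (cdiff z) = 0.
Proof.
apply/ffunP => c; rewrite !ffunE.
under eq_bigr do rewrite ffunE mulr_suml.
rewrite exchange_big /= big1 // => b _.
transitivity ((z b : R) * \sum_x cdmat b x * cdmat x c).
  by rewrite mulr_sumr; apply: eq_bigr => x _; rewrite -mulrA.
by rewrite cdmat_sq mulr0.
Qed.

Definition homog_chain (i : nat) (z : chains) : bool :=
  [forall b, (z b != 0) ==> (hdeg b == i)].

Fact homog_chain_lin i a (x y : chains) :
  homog_chain i x -> homog_chain i y -> homog_chain i (a *: x + y).
Proof.
move=> /forallP hx /forallP hy; apply/forallP => b; apply/implyP.
apply: contraNT => ne; move: (hx b) (hy b).
rewrite (negPf ne) !implybF !negbK => /eqP x0 /eqP y0.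
by rewrite !ffunE x0 y0 scaler0 addr0.
Qed.

Fact homog_chain0 i : homog_chain i 0.
Proof. by apply/forallP => b; rewrite ffunE eqxx. Qed.

Definition cycle_pred (i : nat) : {pred chains} :=
  fun z => homog_chain i z && (cdiff z == 0).

Fact cycle_pred_submod i : submod_closed (cycle_pred i).
Proof.
split; first by rewrite unfold_in /cycle_pred homog_chain0 linear0 eqxx.
move=> a x y /andP[hx /eqP dx] /andP[hy /eqP dy].
by rewrite unfold_in /cycle_pred homog_chain_lin //= cdiff_is_linear dx dy scaler0 addr0.
Qed.

HB.instance Definition _ i := GRing.isSubmodClosed.Build R chains (cycle_pred i)
  (cycle_pred_submod i).

Definition cycles (i : nat) : Type := {z : chains | z \in cycle_pred i}.

HB.instance Definition _ i := SubChoice.on (cycles i).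
HB.instance Definition _ i := [SubChoice_isSubLmodule of cycles i by <:].

Definition boundary_pred (i : nat) : {pred cycles i} :=
  fun z => `[< exists2 y : chains, homog_chain i.+1 y & val z = cdiff y >].

Fact boundary_pred_submod i : submod_closed (@boundary_pred i).
Proof.
split.
  by apply/asboolP; exists 0; [exact: homog_chain0 | rewrite !linear0].
move=> a x y /asboolP[x' hx ex] /asboolP[y' hy ey]; apply/asboolP.
exists (a *: x' + y'); first exact: homog_chain_lin.
by rewrite linearP /= ex ey cdiff_is_linear.
Qed.

Definition boundaries (i : nat) : submodule (cycles i) :=
  Submodule (boundary_pred_submod i).

Definition homology (i : nat) : lmodType R := lquot (boundaries i).

(* The complex vanishes above the largest degree of a basis element. *)
Definition total_homology : lmodType R :=
  dirsum (fun i : 'I_(\max_(b : cbasis C) hdeg b).+1 => homology i).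

End Homology.

Section Constructions.
Variables (R : comPzRingType).

(* d(b ⊗ b') = d b ⊗ b' + (-1)^(hdeg b) b ⊗ d b' *)
Section Tensor.
Variables (C D : complex R).

Definition tensor_deg (b : cbasis C * cbasis D) : nat := hdeg b.1 + hdeg b.2.

Definition tensor_dmat (b c : cbasis C * cbasis D) : R :=
  (if b.2 == c.2 then cdmat b.1 c.1 else 0) +
  (if b.1 == c.1 then (-1) ^+ hdeg b.1 * cdmat b.2 c.2 else 0).

Fact tensor_dmat_deg b c :
  tensor_dmat b c != 0 -> tensor_deg b = (tensor_deg c).+1.
Proof.
rewrite /tensor_dmat /tensor_deg.
have [z1|n1] := eqVneq (cdmat b.1 c.1) 0.
  have [z2|n2] := eqVneq (cdmat b.2 c.2) 0.
    by rewrite z1 z2 mulr0 !if_same addr0 eqxx.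
  rewrite z1 if_same add0r; case: ifP => [/eqP -> _|_]; last by rewrite eqxx.
  by rewrite (cdmat_deg n2) addnS.
case: ifP => [/eqP -> _|_]; first by rewrite (cdmat_deg n1) addSn.
rewrite add0r; case: ifP => [/eqP e|_]; last by rewrite eqxx.
by move: (cdmat_deg n1); rewrite e => /n_Sn.
Qed.

Lemma sum_eqr (T : finType) (t : T) (F : T -> R) :
  \sum_x (if x == t then F x else 0) = F t.
Proof. by rewrite -big_mkcond big_pred1_eq. Qed.

Lemma sum_eql (T : finType) (t : T) (F : T -> R) :
  \sum_x (if t == x then F x else 0) = F t.
Proof. by rewrite -(sum_eqr t F); apply: eq_bigr => x _; rewrite eq_sym. Qed.

Fact tensor_dmat_sq b c : \sum_x tensor_dmat b x * tensor_dmat x c = 0.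
Proof.
case: b c => b1 b2 [c1 c2].
pose s (u : cbasis C) : R := (-1) ^+ hdeg u.
transitivity (\sum_x1 \sum_x2
  ((if b2 == x2 then cdmat b1 x1 else 0) * (if x2 == c2 then cdmat x1 c1 else 0)
  + (if b2 == x2 then
       if x1 == c1 then cdmat b1 x1 * (s x1 * cdmat x2 c2) else 0 else 0)
  + (if x2 == c2 then
       if b1 == x1 then s b1 * cdmat b2 x2 * cdmat x1 c1 else 0 else 0)
  + (if b1 == x1 then s b1 * cdmat b2 x2 else 0) *
    (if x1 == c1 then s x1 * cdmat x2 c2 else 0))).
  rewrite pair_bigA; apply: eq_bigr => -[x1 x2] _ /=.
  rewrite /tensor_dmat /= mulrDl !mulrDr !addrA -/(s b1) -/(s x1).
  by congr (_ + _ + _ + _); do 4?case: eqP => _; rewrite ?mul0r ?mulr0.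
under eq_bigr do rewrite !big_split /=.
rewrite !big_split /=.
have -> : \sum_x1 \sum_x2
    (if b2 == x2 then cdmat b1 x1 else 0) *
    (if x2 == c2 then cdmat x1 c1 else 0) = 0 :> R.
  rewrite exchange_big big1 // => x2 _; case: eqP => _.
    by case: eqP => _; rewrite ?cdmat_sq // big1 // => x _; rewrite mulr0.
  by rewrite big1 // => x _; rewrite mul0r.
have -> : \sum_x1 \sum_x2
    (if b1 == x1 then s b1 * cdmat b2 x2 else 0) *
    (if x1 == c1 then s x1 * cdmat x2 c2 else 0) = 0 :> R.
  rewrite big1 // => x1 _; case: eqP => _; last first.
    by rewrite big1 // => x _; rewrite mul0r.
  case: eqP => _; last by rewrite big1 // => x _; rewrite mulr0.
  transitivity (s b1 * s x1 * \sum_x2 cdmat b2 x2 * cdmat x2 c2).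
    by rewrite mulr_sumr; apply: eq_bigr => x2 _; rewrite mulrACA.
  by rewrite cdmat_sq mulr0.
rewrite add0r addr0.
under eq_bigr do rewrite sum_eql; rewrite sum_eqr.
under eq_bigr do rewrite sum_eqr; rewrite sum_eql.
have [->|nz] := eqVneq (cdmat b1 c1) 0; first by rewrite mul0r mulr0 addr0.
rewrite /s (cdmat_deg nz) exprS mulN1r !mulNr.
by rewrite [cdmat b1 c1 * _]mulrC subrr.
Qed.

Definition tensor : complex R := Complex tensor_dmat_deg tensor_dmat_sq.

End Tensor.

Definition unit_complex : complex R.
Proof.
by refine (@Complex R unit (fun _ => 0%N) (fun _ _ => 0) _ _) => [b c|b c];
  rewrite ?eqxx // big1 // => x _; rewrite mul0r.
Defined.

(* [true] is the generator in degree 1, [false] the generator in degree 0. *)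
Definition koszul1 (r : R) : complex R.
Proof.
refine (@Complex R bool nat_of_bool (fun b c => if b && ~~ c then r else 0) _ _).
  by case=> [] []; rewrite ?eqxx.
by case=> [] []; rewrite big_bool /= !(mul0r, mulr0) addr0.
Defined.

Definition koszul (s : seq R) : complex R :=
  foldr (fun r C => tensor (koszul1 r) C) unit_complex s.

Definition in_ideal (s : seq R) (p : R) : Prop :=
  exists c : 'I_(size s) -> R, p = \sum_(i < size s) c i * s`_i.

End Constructions.

Section BaseChange.
Variables (R S : comPzRingType) (f : {rmorphism R -> S}) (C : complex R).

Fact base_change_deg b c : f (@cdmat R C b c) != 0 -> hdeg b = (hdeg c).+1.
Proof.
case: (eqVneq (cdmat b c) 0) => [->|nz _]; first by rewrite rmorph0 eqxx.
exact: cdmat_deg.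
Qed.

Fact base_change_sq (b c : cbasis C) :
  \sum_x f (cdmat b x) * f (cdmat x c) = 0.
Proof. by under eq_bigr do rewrite -rmorphM; rewrite -rmorph_sum cdmat_sq rmorph0. Qed.

Definition base_change : complex S := Complex base_change_deg base_change_sq.

End BaseChange.

(* R[T], the polynomial ring whose variables are the elements of T *)
Notation polyT R T := {mpoly R[#|{: T}|]}.

Definition pvar (R : comNzRingType) (T : finType) (t : T) : polyT R T :=
  'X_(enum_rank t).

(* The inclusion R[A] -> R[T], for A a subset of T *)
Definition poly_sub (R : comNzRingType) (T : finType) (A : {set T}) :
    {rmorphism polyT R {t : T | t \in A} -> polyT R T} :=
  comp_mpoly [tuple pvar R (val (enum_val i)) | i < #|{: {t : T | t \in A}}|].

Record digraph := Digraph {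
  vert : finType;
  edge : finType;
  src : edge -> vert;
  tgt : edge -> vert;
  no_isolated : forall w : vert, exists e : edge, src e = w \/ tgt e = w
}.

Section Digraph.
Variable G : digraph.
Implicit Types (v w : vert G) (c : seq (edge G)) (S F : {set edge G}).

Definition out_edges w : {set edge G} := [set e | src e == w].
Definition in_edges w : {set edge G} := [set e | tgt e == w].
Definition inc v : {set edge G} := out_edges v :|: in_edges v.

Definition dicycle c : bool :=
  [&& c != [::], path.cycle (fun e f => tgt e == src f) c & uniq (map (@src G) c)].

(* A directed cycle, taken up to circular permutation, is given by its set of
   edges. *)
Definition dicycle_at v S : bool :=
  `[< exists c, [/\ dicycle c, v \in map (@src G) c & S = [set e in c]] >].

Definition alpha v : nat :=
  \max_(P : {set {set edge G}} |
         finset.trivIset P && [forall S in P, dicycle_at v S]) #|P|.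

Definition destroys v F : bool :=
  [forall S : {set edge G}, dicycle_at v S ==> ~~ [disjoint S & F]].

Lemma destroys_inc v : destroys v (inc v).
Proof.
apply/forallP => S; apply/implyP => /asboolP[c [_ /mapP[e ec ->] ->]].
by apply/pred0Pn; exists e; rewrite /= !inE ec eqxx.
Qed.

(* By [destroys_inc], the minimum is over a nonempty set. *)
Definition beta v : nat :=
  #|[arg min_(F < inc v | (F \subset inc v) && destroys v F) #|F|]|.

(* e_l evaluated at the variables in S *)
Definition esym S (l : nat) : polyT int (edge G) :=
  mesym #|S| int l \mPo [tuple pvar int (enum_val i) | i < #|S|].

Definition delta w (l : nat) : polyT int (edge G) :=
  esym (out_edges w) l - esym (in_edges w) l.

Definition Delta : seq (polyT int (edge G)) :=
  [seq delta w l | w <- enum (vert G),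
                   l <- iota 1 (maxn #|out_edges w| #|in_edges w|)].

Definition koszulG : complex (polyT int (edge G)) := koszul Delta.

(* ℚ ⊗ C, where ℚ ⊗ ℤ[E] is identified with ℚ[E]. *)
Definition koszulGQ : complex (polyT rat (edge G)) :=
  base_change (map_mpoly (intr : int -> rat)) koszulG.

Definition HG0 v : lmodType (polyT int {e | e \in inc v}) :=
  restr_scal (poly_sub int (inc v)) (homology koszulG 0).

Definition HGstar v : lmodType (polyT int {e | e \in inc v}) :=
  restr_scal (poly_sub int (inc v)) (total_homology koszulG).

Definition HG0Q v : lmodType (polyT rat {e | e \in inc v}) :=
  restr_scal (poly_sub rat (inc v)) (homology koszulGQ 0).

End Digraph.

(* Main.v *)
(** Both the annihilator of H_0 and that of H_* (Koszul homology is killed by the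
    sequence, by a null-homotopy) are the contraction of I(G). A point of Spec
    over I(G) with values in a field is a labelling of the edges such that at each
    vertex prod (1 + x T) over the outgoing edges equals the same product over
    the incoming ones; equivalently every level set of a nonzero value is
    balanced, and a balanced set with an edge at v contains a directed cycle
    through v. So at most alpha_v nonzero values occur on the edges at v, and
    disjoint cycles conversely carry independent labels: the dimension over Q is
    exactly alpha_v, and the one over Z is alpha_v + 1, while alpha_v <= beta_v is
    clear.

    The bound on the length of a chain P_0 < ... < P_n of primes is obtained from
    elements x_i of P_(i+1) outside P_i: among any d + 2 elements of
    Z[y_1, ..., y_d] there is a polynomial relation with coefficients 0, 1, -1 (by
    the pigeonhole principle), and successively dividing it by a power of x_i and
    discarding the multiples of x_i leaves a unit in the last prime. *)
Require Import Defs.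
From HB Require Import structures.
From mathcomp Require Import all_boot all_order all_algebra.
From mathcomp Require Import ring_quotient fraction.
From mathcomp Require Import mpoly.
From mathcomp Require Import boolp classical_sets constructive_ereal.
From mathcomp Require Import ring zify.

Set Implicit Arguments.
Unset Strict Implicit.
Unset Printing Implicit Defensive.

Import Order.TTheory GRing.Theory Num.Theory.

Local Open Scope ring_scope.
Local Open Scope quotient_scope.

(** * Primes avoiding a multiplicative set, and points with values in a field *)

(** An ideal maximal among those containing [I] and disjoint from [S] is prime: if [x] and [y] lie
    outside it, adjoining either one produces an element of [S], and the product of these two
    elements would lie in the ideal as soon as [x * y] does. *)
Lemma prime_avoiding (R : comNzRingType) (I S : set R) :
    I 0 -> (forall x y, I x -> I y -> I (x + y)) ->
    (forall a x, I x -> I (a * x)) ->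
    S 1 -> (forall x y, S x -> S y -> S (x * y)) -> (forall x, I x -> ~ S x) ->
  exists Q : set R,
    [/\ prime_ideal Q, (I `<=` Q)%classic & forall x, S x -> ~ Q x].
Proof.
move=> I0 ID IM S1 SM disj.
pose ideal (X : set R) := [/\ X 0, forall x y, X x -> X y -> X (x + y) &
  forall a x, X x -> X (a * x)].
pose adm (X : set R) := ideal X /\ forall x, X x -> ~ S x.
(* Zorn's lemma is applied to all chains, the empty one included; adjoining [I] makes the empty
   union admissible. *)
pose P (X : set R) := adm (X `|` I)%classic.
have [F FP Ftot|A [[[A0 AD AM] AS] Amax]] := @Zorn_bigcup R P.
  split; last first.
    move=> x [[X FX Xx]|/disj //]; by case: (FP X FX) => _; apply; left.
  split.
  - by right.
  - move=> x y [[X FX Xx]|Ix] [[Y FY Yy]|Iy]; last by right; apply: ID.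
    + have [Z FZ [Zx Zy]] : exists2 Z, F Z & Z x /\ Z y.
        by case: (Ftot X Y FX FY) => h; [exists Y|exists X] => //; split=> //;
          apply: h.
      case: (FP Z FZ) => -[_ h _] _.
      case: (h x y (or_introl Zx) (or_introl Zy)) => k; [left|right] => //.
      by exists Z.
    + case: (FP X FX) => -[_ h _] _.
      case: (h x y (or_introl Xx) (or_intror Iy)) => k; [left|right] => //.
      by exists X.
    + case: (FP Y FY) => -[_ h _] _.
      case: (h x y (or_intror Ix) (or_introl Yy)) => k; [left|right] => //.
      by exists Y.
  - move=> a x [[X FX Xx]|Ix]; last by right; apply: IM.
    case: (FP X FX) => -[_ _ h] _.
    case: (h a x (or_introl Xx)) => k; [left|right] => //.
    by exists X.
set Q := (A `|` I)%classic in A0 AD AM AS.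
have IQ : (I `<=` Q)%classic by move=> x; right.
exists Q; split=> //; last by move=> x Sx /AS.
(* By maximality an ideal strictly larger than Q meets S. *)
have meet x : ~ Q x -> exists a q, Q q /\ S (q + a * x).
  move=> nQx; apply: contrapT => nex.
  pose B : set R := fun z => exists a q, Q q /\ z = q + a * x.
  have QB : (Q `<=` B)%classic by move=> q Qq; exists 0, q; rewrite mul0r addr0.
  apply: (Amax B).
    split; first by move=> y Ay; apply: QB; left.
    move=> BA; apply: nQx; left; apply: BA; exists 1, 0.
    by rewrite add0r mul1r.
  have -> : P B = adm B.
    congr adm; apply/seteqP; split=> y; last by left.
    by case=> // /IQ /QB.
  split; last by move=> _ [a [q [Qq ->]]] Sz; apply: nex; exists a, q.
  split; first exact: QB.
  - move=> _ _ [a [q [Qq ->]]] [b [r [Qr ->]]]; exists (a + b), (q + r).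
    by split; [exact: AD | rewrite mulrDl addrACA].
  - move=> c _ [a [q [Qq ->]]]; exists (c * a), (c * q).
    by split; [exact: AM | rewrite mulrDr mulrA].
split=> //; first by move=> /AS.
move=> x y Qxy; apply: contrapT => /not_orP[nx ny].
have [a [q [Qq Sx]]] := meet x nx; have [b [r [Qr Sy]]] := meet y ny.
apply: (AS _ _ (SM _ _ Sx Sy)).
have -> : (q + a * x) * (r + b * y) =
    (r + b * y) * q + (a * x * r + a * b * (x * y)) by ring.
by apply: (AD); [exact: AM | apply: (AD); exact: AM].
Qed.

Section PrimeQuotient.
Variables (R : comNzRingType) (Q : set R) (prQ : prime_ideal Q).

(* The dummy [let] keeps the primality proof as an argument of [prime_pred], so
   that the instances below can depend on it. *)
Definition prime_pred : {pred R} := let _ := prQ in fun x => `[< Q x >].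

Fact prime_pred_idealr : idealr_closed prime_pred.
Proof.
split; first by apply/asboolP; case: prQ.
  by apply/asboolP; case: prQ.
move=> a x y /asboolP Qx /asboolP Qy; apply/asboolP.
by case: prQ => _ QD QM _ _; apply: QD => //; apply: QM.
Qed.

HB.instance Definition _ := isIdealr.Build R prime_pred prime_pred_idealr.

Fact prime_pred_prime : prime_idealr_closed prime_pred.
Proof.
move=> x y /asboolP Qxy; apply/orP.
by case: prQ => _ _ _ _ /(_ _ _ Qxy)[h|h]; [left|right]; apply/asboolP.
Qed.

HB.instance Definition _ :=
  isPrimeIdealrClosed.Build R prime_pred prime_pred_prime.

Definition prime_quot : Type := (Quotient.quot prime_pred).

HB.instance Definition _ := GRing.ComNzRing.on prime_quot.

(** Units and inverses are chosen classically, because the fraction field is formed over an integral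
    domain with a unit structure. *)
Definition prime_quot_unit : pred prime_quot := fun x => `[< exists y, y * x = 1 >].
Definition prime_quot_inv (x : prime_quot) : prime_quot :=
  if pselect (exists y, y * x = 1) is left h then projT1 (cid h) else x.

Fact prime_quot_mulVx : {in prime_quot_unit, left_inverse 1 prime_quot_inv *%R}.
Proof.
move=> x /asboolP hx; rewrite /prime_quot_inv; case: pselect => // h.
by case: cid.
Qed.

Fact prime_quot_unitPl (x y : prime_quot) : y * x = 1 -> prime_quot_unit x.
Proof. by move=> h; apply/asboolP; exists y. Qed.

Fact prime_quot_inv_out : {in [predC prime_quot_unit], prime_quot_inv =1 id}.
Proof.
move=> x /asboolPn hx; rewrite /prime_quot_inv; by case: pselect.
Qed.

HB.instance Definition _ := GRing.ComNzRing_hasMulInverse.Build prime_quot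
  prime_quot_mulVx prime_quot_unitPl prime_quot_inv_out.

Fact prime_quot_integral (x y : prime_quot) :
  x * y = 0 -> (x == 0) || (y == 0).
Proof. exact: Quotient.rquot_IdomainAxiom. Qed.

HB.instance Definition _ :=
  GRing.ComUnitRing_isIntegral.Build prime_quot prime_quot_integral.

Definition prime_quot_pi (x : R) : prime_quot := \pi_(Quotient.quot prime_pred) x.

Fact prime_quot_pi_zmod : zmod_morphism prime_quot_pi.
Proof. by move=> x y; rewrite /prime_quot_pi [LHS]raddfB. Qed.
Fact prime_quot_pi_monoid : monoid_morphism prime_quot_pi.
Proof.
by split=> [|x y]; rewrite /prime_quot_pi; [rewrite [LHS]rmorph1|rewrite [LHS]rmorphM].
Qed.

HB.instance Definition _ := GRing.isZmodMorphism.Build R prime_quot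
  prime_quot_pi prime_quot_pi_zmod.
HB.instance Definition _ := GRing.isMonoidMorphism.Build R prime_quot
  prime_quot_pi prime_quot_pi_monoid.

Lemma prime_quot_pi_eq0 x : (prime_quot_pi x = 0) <-> Q x.
Proof.
have e : (x \in prime_pred) = (prime_quot_pi x == 0).
  by rewrite -[X in X \in _]subr0 Quotient.idealrBE -(rmorph0 prime_quot_pi).
split=> [/eqP|h]; first by rewrite -e => /asboolP.
by apply/eqP; rewrite -e; apply/asboolP.
Qed.

End PrimeQuotient.

(** The point is the map to the fraction field of [R / Q]. It is used with [S] the powers of an edge
    variable, to prove nilpotency, and with [S] the image of the complement of a prime of a
    subring. *)
Lemma field_avoiding (R : comNzRingType) (I S : set R) :
    I 0 -> (forall x y, I x -> I y -> I (x + y)) ->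
    (forall a x, I x -> I (a * x)) ->
    S 1 -> (forall x y, S x -> S y -> S (x * y)) -> (forall x, I x -> ~ S x) ->
  exists (K : fieldType) (f : {rmorphism R -> K}),
    (forall x, I x -> f x = 0) /\ (forall x, S x -> f x != 0).
Proof.
move=> I0 ID IM S1 SM disj.
have [Q [prQ IQ SQ]] := prime_avoiding I0 ID IM S1 SM disj.
exists {fraction (prime_quot prQ)},
  (@FracField.tofrac (prime_quot prQ) \o prime_quot_pi prQ).
split=> x h /=.
  apply/eqP; rewrite tofrac_eq0; apply/eqP.
  by apply/prime_quot_pi_eq0; exact: IQ.
by rewrite tofrac_eq0; apply/eqP => /prime_quot_pi_eq0; exact: SQ.
Qed.

(** * Finitely generated ideals and the annihilator of the 0-th homology *)

Section InIdeal.
Variable R : comPzRingType.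
Implicit Types (s : seq R) (p q : R).

Lemma in_ideal0 s : in_ideal s 0.
Proof. by exists (fun=> 0); rewrite big1 // => i _; rewrite mul0r. Qed.

Lemma in_idealD s p q : in_ideal s p -> in_ideal s q -> in_ideal s (p + q).
Proof.
move=> [c ->] [d ->]; exists (fun i => c i + d i).
by rewrite -big_split; apply: eq_bigr => i _; rewrite mulrDl.
Qed.

Lemma in_idealM s a p : in_ideal s p -> in_ideal s (a * p).
Proof.
move=> [c ->]; exists (fun i => a * c i).
by rewrite mulr_sumr; apply: eq_bigr => i _; rewrite mulrA.
Qed.

Lemma in_ideal_mem s p : p \in s -> in_ideal s p.
Proof.
move=> ps; exists (fun i : 'I_(size s) => (val i == index p s)%:R).
have lt : (index p s < size s)%N by rewrite index_mem.
rewrite (bigD1 (Ordinal lt)) //= eqxx mul1r nth_index // big1 ?addr0 // => i ne.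
by rewrite (negPf (_ : val i != _)) ?mul0r.
Qed.

Lemma in_ideal_min s (J : set R) :
    J 0 -> (forall x y, J x -> J y -> J (x + y)) ->
    (forall a x, J x -> J (a * x)) -> (forall x, x \in s -> J x) ->
  forall p, in_ideal s p -> J p.
Proof.
move=> J0 JD JM Js p [c ->]; elim/big_ind: _ => // i _.
by apply: JM; apply: Js; apply: mem_nth.
Qed.

Lemma in_ideal_cons r s p :
  in_ideal (r :: s) p <-> exists a q, in_ideal s q /\ p = a * r + q.
Proof.
split=> [[c ->]|[a [q [sq ->]]]].
  exists (c ord0), (\sum_(i < size s) c (lift ord0 i) * s`_i).
  by split; [exists (fun i => c (lift ord0 i)) | rewrite big_ord_recl].
apply: in_idealD; first by apply: in_idealM; apply: in_ideal_mem; rewrite mem_head.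
move: sq; apply: in_ideal_min.
- exact: in_ideal0.
- exact: in_idealD.
- exact: in_idealM.
- by move=> x xs; apply: in_ideal_mem; rewrite inE xs orbT.
Qed.

End InIdeal.

Section BaseElement.
Variables (R S : comPzRingType) (f : {rmorphism R -> S}).

(** Induction on the list: [(true, b0)] contributes the head [r], the elements [(false, b)]
    contribute the ideal of the tail, and the other [(true, b)] contribute nothing. The map [f] lets
    the same statement serve the complex over the integers and its base change to the rationals. *)
Lemma koszul_base (s : seq R) : exists b0 : cbasis (koszul s),
  (forall b : cbasis (koszul s), (hdeg b == 0%N) = (b == b0)) /\
  (forall p : S, in_ideal (map f s) p <->
    exists y : cbasis (koszul s) -> S, p = \sum_b y b * f (cdmat b b0)).
Proof.
elim: s => [|r s [b0 [deg0 gen]]].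
  exists tt; split=> [[] //|p]; split=> [[c ->]|[y ->]].
    by exists (fun=> 0); rewrite big_ord0 big1 // => b _; rewrite mul0r.
  by rewrite big1 => [|b _]; [exact: in_ideal0 | rewrite rmorph0 mulr0].
exists (false, b0); split=> [[u b]|p] /=.
  by rewrite /tensor_deg addn_eq0 deg0 /= xpair_eqE; case: u.
pose K := koszul (r :: s).
have d_true b : @cdmat R K (true, b) (false, b0) = (if b == b0 then r else 0).
  by rewrite /= /tensor_dmat /= addr0.
have d_false b : @cdmat R K (false, b) (false, b0) = cdmat b b0.
  by rewrite /= /tensor_dmat /= expr0 mul1r if_same add0r.
have sumE (y : bool * cbasis (koszul s) -> S) :
    \sum_b y b * f (@cdmat R K b (false, b0)) =
    y (true, b0) * f r + \sum_b y (false, b) * f (cdmat b b0).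
  rewrite (eq_bigr (fun b => y (b.1, b.2) * f (@cdmat R K (b.1, b.2) (false, b0))));
    last by case.
  rewrite -(pair_bigA _ (fun u b => y (u, b) * f (@cdmat R K (u, b) (false, b0)))).
  rewrite big_bool; congr (_ + _); last first.
    by apply: eq_bigr => b _; rewrite -d_false.
  rewrite (bigD1 b0) // d_true eqxx big1; first by rewrite /= addr0.
  by move=> b ne; rewrite d_true (negPf ne) rmorph0 mulr0.
rewrite in_ideal_cons; split=> [[a [q [/gen[y ->] ->]]]|[y ->]].
  by exists (fun b => if b.1 then a else y b.2); rewrite sumE.
rewrite sumE; exists (y (true, b0)), (\sum_b y (false, b) * f (cdmat b b0)).
by split=> //; apply/gen; exists (fun b => y (false, b)).
Qed.

End BaseElement.

Section LquotExtra.
Variables (R : pzRingType) (M : lmodType R) (U : submodule M).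

Lemma lquot_pi_eq0 (x : M) : lquot_pi U x = 0 <-> x \in U.
Proof.
have e : lquot_pi U 0 = 0.
  by apply: (@addrI _ (lquot_pi U 0)); rewrite -lquot_piD !addr0.
by rewrite -e lquot_piP subr0.
Qed.

Lemma lquot_scale_pi (a : R) (x : M) : a *: lquot_pi U x = lquot_pi U (a *: x).
Proof. exact: lquot_pi_scale. Qed.

End LquotExtra.

(** With a single basis element in degree 0, the 0-th homology is cyclic, generated by the class of
    [b0], and its annihilator is the ideal of the coefficients with which boundaries hit [b0]. *)
Lemma homology0_ann (R : comPzRingType) (C : complex R) (b0 : cbasis C) (a : R) :
    (forall b : cbasis C, (hdeg b == 0%N) = (b == b0)) ->
  (forall m : homology C 0, a *: m = 0) <->
  exists y : cbasis C -> R, a = \sum_b y b * cdmat b b0.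
Proof.
move=> deg0.
have hdeg0 : hdeg b0 = 0%N by apply/eqP; rewrite deg0.
have d0 c : cdmat b0 c = 0.
  by apply/eqP; apply: contraT => /cdmat_deg; rewrite hdeg0.
split=> [ann_a|[y ay] m].
  pose z : chains C := [ffun b => (b == b0)%:R].
  have zc : z \in @cycle_pred R C 0.
    rewrite unfold_in; apply/andP; split.
      apply/forallP => b; rewrite ffunE deg0; apply/implyP.
      by apply: contraNT => /negPf ->.
    apply/eqP/ffunP => c; rewrite !ffunE big1 // => b _; rewrite ffunE.
    by have [->|_] := eqVneq b b0; rewrite ?d0 ?mulr0 ?mul0r.
  have := ann_a (lquot_pi (boundaries C 0) (Sub z zc : cycles C 0)).
  rewrite lquot_scale_pi => /lquot_pi_eq0 /asboolP[y _].
  rewrite linearZ /= => /ffunP /(_ b0); rewrite !ffunE eqxx => e.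
  by exists y; rewrite -[LHS](mulr1 a); exact: e.
rewrite -[m]lquot_reprK; set z : cycles C 0 := lquot_repr m.
rewrite lquot_scale_pi; apply/lquot_pi_eq0/asboolP.
have /andP[/forallP zh _] : val z \in @cycle_pred R C 0 by exact: valP.
(* A boundary needs a homogeneous preimage. Cutting down to degree 1 loses nothing, since elements
   of other degrees have coefficient 0 at [b0]. *)
exists [ffun b => if hdeg b == 1%N then y b * val z b0 else 0].
  apply/forallP => b; rewrite ffunE; case: ifP => _; first by rewrite implybT.
  by rewrite eqxx.
rewrite linearZ /=; apply/ffunP => c; rewrite !ffunE.
have [->|nc] := eqVneq c b0.
  rewrite {1}ay /GRing.scale /= mulr_suml; apply: eq_bigr => b _; rewrite ffunE.
  have [|nd] := eqVneq (cdmat b b0) 0; first by move=> ->; rewrite !mulr0 mul0r.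
  by rewrite (cdmat_deg nd) hdeg0 eqxx mulrAC.
have /eqP -> : val z c == 0.
  by apply: contraNT nc => zc; rewrite -deg0; have := zh c; rewrite zc.
rewrite scaler0 big1 // => b _; rewrite ffunE.
have [->|nd] := eqVneq (cdmat b c) 0; first by rewrite mulr0.
case: ifP => [/eqP e|_]; last by rewrite mul0r.
by move: (cdmat_deg nd); rewrite e => -[/esym/eqP]; rewrite deg0 (negPf nc).
Qed.

(** * Null-homotopies on Koszul complexes *)

Section Homotopy.
Variable R : comPzRingType.

Definition null_homotopic (C : complex R) (r : R) : Prop :=
  exists H : cbasis C -> cbasis C -> R,
    (forall b c, H b c != 0 -> hdeg c = (hdeg b).+1) /\
    (forall b c, \sum_x (H b x * cdmat x c + cdmat b x * H x c) =
       (if b == c then r else 0)).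

(** For the head of the list the homotopy moves the first tensor factor from degree 0 to degree 1.
    For an element of the tail it is the identity of the first factor tensored with the homotopy of
    the tail, with the Koszul sign. *)
Lemma null_homotopic_koszul (s : seq R) (r : R) :
  r \in s -> null_homotopic (koszul s) r.
Proof.
elim: s => // q s IH; rewrite inE.
pose K := koszul (q :: s).
have sumE (F : bool * cbasis (koszul s) -> R) :
    \sum_x F x = \sum_x F (true, x) + \sum_x F (false, x).
  rewrite (eq_bigr (fun x => F (x.1, x.2))); last by case.
  by rewrite -(pair_bigA _ (fun u x => F (u, x))) big_bool.
have [->|nrq] /= := eqVneq r q => [_|/IH [H [Hdeg Heq]]].
  exists (fun b c => if [&& ~~ b.1, c.1 & b.2 == c.2] then 1 else 0).
  split=> [[[] b] [[] c]|[u b] [t c]] /=; rewrite ?eqxx //.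
    by case: (eqVneq b c) => [->|_]; rewrite ?eqxx.
  rewrite sumE.
  (* [D t u b c] is the coefficient of [(u, c)] in the differential of [(t, b)]; each of the two
     sums below collapses to one such entry. *)
  pose D (t u : bool) (b c : cbasis (koszul s)) : R :=
    (if b == c then if t && ~~ u then q else 0 else 0)
    + (if t == u then (-1) ^+ t * cdmat b c else 0).
  have -> : \sum_x (((if [&& ~~ u, true & b == x] then 1 else 0) *
      @cdmat R K (true, x) (t, c)) + @cdmat R K (u, b) (true, x) *
      (if [&& ~~ true, t & x == c] then 1 else 0)) =
      (if u then 0 else D true t b c).
    case: u => /=; first by rewrite big1 // => x _; rewrite mul0r mulr0 addr0.
    transitivity (\sum_x (if b == x then D true t x c else 0)); last first.
      exact: (sum_eql b (fun x => D true t x c)).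
    apply: eq_bigr => x _.
    by rewrite mulr0 addr0; case: eqP => _; rewrite ?mul1r ?mul0r.
  have -> : \sum_x (((if [&& ~~ u, false & b == x] then 1 else 0) *
      @cdmat R K (false, x) (t, c)) + @cdmat R K (u, b) (false, x) *
      (if [&& ~~ false, t & x == c] then 1 else 0)) =
      (if t then D u false b c else 0).
    case: t => /=; last first.
      by rewrite big1 // => x _; rewrite andbF mul0r mulr0 addr0.
    transitivity (\sum_x (if x == c then D u false b x else 0)); last first.
      exact: (sum_eqr c (fun x => D u false b x)).
    apply: eq_bigr => x _.
    by rewrite andbF mul0r add0r; case: eqP => _; rewrite ?mulr1 ?mulr0.
  rewrite /D xpair_eqE; case: u; case: t => /=;
    rewrite ?if_same ?expr0 ?expr1 ?mul1r ?mulN1r ?addr0 ?add0r ?addNr //.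
exists (fun b c : bool * cbasis (koszul s) =>
  if b.1 == c.1 then (-1) ^+ b.1 * H b.2 c.2 else 0).
split=> [[u b] [t c]|[u b] [t c]] /=.
  have [->|_] := eqVneq u t; last by rewrite eqxx.
  have [->|/Hdeg h _] := eqVneq (H b c) 0; first by rewrite mulr0 eqxx.
  by rewrite /tensor_deg /= h addnS.
rewrite sumE /= xpair_eqE.
have e1 F G : \sum_(x : cbasis (koszul s)) ((0 : R) * F x + G x * (0 : R)) = 0.
  by rewrite big1 // => x _; rewrite mul0r mulr0 addr0.
case: u; case: t => /=; rewrite /tensor_dmat /= ?expr0 ?expr1 ?e1 ?addr0 ?add0r.
- rewrite -Heq; apply: eq_bigr => x _; rewrite !if_same !add0r; ring.
(* The only entry in which [q] survives: the sign in the homotopy makes its two contributions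
   cancel. *)
- have -> : \sum_x (-1 * H b x * ((if x == c then q else 0) + 0) +
      ((if b == x then 0 else 0) + -1 * cdmat b x) * 0) = - (q * H b c).
    rewrite -(sum_eqr c (fun x => q * H b x)) -sumrN; apply: eq_bigr => x _.
    by rewrite !if_same; case: eqP => _; ring.
  have -> : \sum_x (0 * ((if x == c then 0 else 0) + 1 * cdmat x c) +
      ((if b == x then q else 0) + 0) * (1 * H x c)) = q * H b c.
    rewrite -(sum_eql b (fun x => q * H x c)); apply: eq_bigr => x _.
    by rewrite !if_same; case: eqP => _; ring.
  by rewrite addNr.
- by rewrite !big1 ?addr0 // => x _; rewrite !if_same; ring.
- by rewrite -Heq; apply: eq_bigr => x _; rewrite !if_same; ring.
Qed.

(** On a cycle [z] the homotopy identity reduces to [r z = d (H z)], because the other term contains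
    [d z]. *)
Lemma null_homotopic_homology (C : complex R) (r : R) i (m : homology C i) :
  null_homotopic C r -> r *: m = 0.
Proof.
move=> [H [Hdeg Heq]].
rewrite -[m]lquot_reprK; set z : cycles C i := lquot_repr m.
rewrite lquot_scale_pi; apply/lquot_pi_eq0/asboolP.
have /andP[/forallP zh /eqP dz] : val z \in @cycle_pred R C i by exact: valP.
exists [ffun c => \sum_b val z b * H b c].
  apply/forallP => c; apply/implyP; rewrite ffunE => nz.
  have [b nb] : exists b, (val z b : R) * H b c != 0.
    apply: contrapT => /forallNP h; move/eqP: nz; apply.
    by apply: big1 => b _; apply/eqP; apply: contrapT => /negP; exact: h.
  have nzb : val z b != 0 by apply: contraNneq nb => ->; rewrite mul0r.
  have nHb : H b c != 0 by apply: contraNneq nb => ->; rewrite mulr0.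
  by rewrite (Hdeg _ _ nHb); have := zh b; rewrite nzb.
rewrite linearZ /=; apply/ffunP => c; rewrite !ffunE.
have dzx x : \sum_b (val z b : R) * cdmat b x = 0.
  by move/ffunP: dz => /(_ x); rewrite !ffunE.
transitivity (\sum_b (val z b : R) * (if b == c then r else 0)).
  rewrite (bigD1 c) //= eqxx big1 ?addr0 => [|b /negPf ->]; last by rewrite mulr0.
  by rewrite /GRing.scale /= mulrC.
under eq_bigr do rewrite -Heq big_split mulrDr !mulr_sumr.
rewrite big_split /= [X in _ + X]exchange_big /= [X in _ + X]big1 ?addr0.
  rewrite exchange_big; apply: eq_bigr => x _; rewrite ffunE mulr_suml.
  by apply: eq_bigr => b _; rewrite mulrA.
move=> x _; under eq_bigr do rewrite mulrA.
by rewrite -mulr_suml dzx mul0r.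
Qed.

End Homotopy.

(** * Points over the ideal as edge labellings *)

Section GeneratingPolynomial.
Variables (G : digraph) (B : comNzRingType).

(** The generating polynomial of the elementary symmetric functions of the labels on [S]. *)
Definition gen_poly (x : edge G -> B) (S : {set edge G}) : {poly B} :=
  \prod_(e in S) (1 + x e *: 'X).

Variable g : {rmorphism polyT int (edge G) -> B}.
Local Notation x := (fun e => g (pvar int e)).

Lemma rmorph_esym (S : {set edge G}) l : g (Defs.esym S l) = (gen_poly x S)`_l.
Proof.
have -> : g (Defs.esym S l) = \sum_(h : {set 'I_#|S|} | #|h| == l)
    \prod_(i in h) x (enum_val i).
  rewrite /Defs.esym /mesym.
  rewrite (rmorph_sum (comp_mpoly _)) (rmorph_sum g); apply: eq_bigr => h _ /=.
  rewrite (rmorph_prod (comp_mpoly _)) (rmorph_prod g); apply: eq_bigr => i _ /=.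
  by rewrite comp_mpolyXU -tnth_nth tnth_mktuple.
have -> : gen_poly x S = \prod_(i < #|S|) (x (enum_val i) *: 'X + 1).
  rewrite /gen_poly (big_enum_val (fun e => 1 + x e *: 'X)).
  by apply: eq_bigr => i _; rewrite addrC.
rewrite bigA_distr coef_sum big_mkcond; apply: eq_bigr => h _.
rewrite -(big_mkcond (mem h)) scaler_prod prodr_const coefZ coefXn eq_sym.
by case: eqP; rewrite ?mulr1 ?mulr0.
Qed.

(** Comparing coefficients gives the equations of [Delta G]; the coefficients they omit agree
    anyway, being 1 in degree 0 and 0 above the larger of the two edge numbers. *)
Lemma rmorph_Delta :
  (forall p, p \in Delta G -> g p = 0) <->
  (forall w, gen_poly x (out_edges w) = gen_poly x (in_edges w)).
Proof.
split=> [g0 w|eq_gen p].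
  apply/polyP => l; rewrite -!rmorph_esym.
  apply/eqP; rewrite -subr_eq0 -rmorphB; apply/eqP.
  have [->|l_gt0] := posnP l.
    by rewrite /Defs.esym !mesym0E !rmorph1 subrr rmorph0.
  have [le_l|gt_l] := leqP l (maxn #|out_edges w| #|in_edges w|).
    apply: g0; apply/allpairsPdep; exists w, l.
    by rewrite mem_enum mem_iota l_gt0 add1n ltnS le_l.
  move: gt_l; rewrite gtn_max => /andP[l1 l2].
  by rewrite /Defs.esym !mesym_geqnE // !rmorph0 subrr rmorph0.
move=> /allpairsPdep[w [l [_ _ ->]]].
by rewrite rmorphB !rmorph_esym eq_gen subrr.
Qed.

End GeneratingPolynomial.

(** A nonzero [x] in the list shows up as the root [- x^-1], so it occurs in the other list too and
    its factor cancels. Zeros give the factor 1 and are invisible. *)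
Lemma prod_1addX_count (K : fieldType) (s t : seq K) (a : K) : a != 0 ->
    \prod_(x <- s) (1 + x *: 'X) = \prod_(x <- t) (1 + x *: 'X) ->
  count_mem a s = count_mem a t.
Proof.
have root_in (x : K) (r : seq K) : x != 0 ->
    (\prod_(y <- r) (1 + y *: 'X)).[- x^-1] = 0 -> x \in r.
  move=> nx; rewrite horner_prod => /eqP.
  rewrite prodf_seq_eq0 => /hasP[y yr /=]; rewrite !hornerE.
  rewrite mulrN subr_eq0 => /eqP e.
  by have -> : x = y by rewrite -[x]mul1r e mulfVK.
move=> na; elim: s t => [|x s IH] t.
  rewrite big_nil => e; apply/esym/eqP; rewrite -leqn0 leqNgt -has_count.
  apply/negP => /hasP[y yt /eqP ya]; have := congr1 (horner^~ (- a^-1)) e.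
  rewrite /= hornerE (big_rem y) //= hornerM ya !hornerE mulrN divff // subrr mul0r.
  by move/eqP; rewrite oner_eq0.
rewrite big_cons; have [->|nx] := eqVneq x 0.
  by rewrite scale0r addr0 mul1r /= eq_sym (negPf na); exact: IH.
move=> e; have xt : x \in t.
  apply: (root_in _ _ nx); rewrite -e hornerM !hornerE mulrN divff //.
  by rewrite subrr mul0r.
move: e; rewrite [RHS](big_rem _ xt) /= => e.
rewrite /= (IH (rem x t)); last first.
  apply: (mulfI _ e); apply/eqP => /(congr1 (horner^~ 0)); rewrite /= !hornerE.
  by move/eqP; rewrite oner_eq0.
by rewrite (permP (perm_to_rem xt)).
Qed.

(** * Balanced edge sets and directed cycles *)

Section Balanced.
Variable G : digraph.
Implicit Types (F : {set edge G}) (w : vert G) (e : edge G).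

Definition balanced F : Prop :=
  forall w, #|F :&: out_edges w| = #|F :&: in_edges w|.

Lemma level_set_balanced (K : fieldType) (x : edge G -> K) (a : K) : a != 0 ->
    (forall w, gen_poly x (out_edges w) = gen_poly x (in_edges w)) ->
  balanced [set e | x e == a]%SET.
Proof.
move=> na eq_gen w.
have card S : #|[set e | x e == a]%SET :&: S| = count_mem a [seq x e | e <- enum S].
  rewrite cardE count_map -size_filter; apply/perm_size/uniq_perm.
  - exact: enum_uniq.
  - by apply/filter_uniq/enum_uniq.
  - by move=> e; rewrite mem_enum mem_filter mem_enum !inE.
rewrite !card; apply: prod_1addX_count na _.
by have := eq_gen w; rewrite /gen_poly !big_map !big_enum.
Qed.

Lemma card_fiber (f : edge G -> vert G) F (W : {set vert G}) :
  #|[set e in F | f e \in W]%SET| = (\sum_(w in W) #|F :&: [set e | f e == w]%SET|)%N.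
Proof.
rewrite -sum1_card (partition_big f (mem W)) /=; last first.
  by move=> e; rewrite inE => /andP[].
apply: eq_bigr => w wW; rewrite -sum1_card; apply: eq_bigl => e.
by rewrite !inE -andbA; case: eqP => [->|_]; rewrite ?andbF // wW.
Qed.

Lemma balanced_dicycle F e : balanced F -> e \in F ->
  exists c, [/\ dicycle c, e \in c & {subset c <= F}].
Proof.
move=> balF eF.
pose r u w := [exists f in F, (src f == u) && (tgt f == w)].
(* The edges of F starting in W also end in W; as F is balanced, there are as many
   of both kinds, so e starts in W. *)
pose W := [set w | connect r (tgt e) w]%SET.
have tgt_eW : tgt e \in W by rewrite inE connect0.
have sub : [set f in F | src f \in W]%SET \subset [set f in F | tgt f \in W]%SET.
  apply/fintype.subsetP => f; rewrite !inE => /andP[fF cf]; rewrite fF /=.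
  apply: connect_trans cf _; apply: connect1.
  by apply/existsP; exists f; rewrite fF !eqxx.
have eqW : [set f in F | src f \in W]%SET = [set f in F | tgt f \in W]%SET.
  apply/eqP; rewrite eqEcard sub /= !card_fiber.
  by apply/eq_leq/eq_bigr => w _; exact/esym/balF.
have : e \in [set f in F | src f \in W]%SET by rewrite eqW inE eF.
rewrite !inE eF /= => /connectP[p0 p0p].
(* A walk in [F] from the end of [e] back to its start, freed of repeated vertices, is closed up by
   [e] to a directed cycle. *)
case/shortenP: p0p => p pp up _ lp0 {p0}.
(* The walk is a list of vertices; each of its steps is lifted to an edge of [F], and the sources of
   these edges are recorded to transfer distinctness. *)
have [c [cF cp sc]] : exists c : seq (edge G), [/\ {subset c <= F},
    path (fun e f => tgt e == src f) e c /\
    tgt (last e c) = last (tgt e) p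
    & map (@src G) c = belast (tgt e) p].
  have : exists2 u, u = tgt e & path r u p by exists (tgt e).
  clear -eF; case=> u ue; move: e eF u ue; elim: p => [|w p IH] e eF u ue /=.
    by move=> _; exists [::]; split.
  move=> /andP[/existsP[f /andP[fF /andP[/eqP fu /eqP fw]]] pp].
  have [c [cF [pc lc] sc]] := IH f fF w (esym fw) pp.
  exists (f :: c); split.
  - by move=> h; rewrite inE => /predU1P[->|/cF].
  - by rewrite /= -ue -fu eqxx lc fw.
  - by rewrite /= fu ue -fw sc.
exists (e :: c); split; last 1 first.
- by move=> h; rewrite inE => /predU1P[->|/cF].
- apply/and3P; split=> //=.
    case: cp => pc lc; rewrite rcons_path pc /= lc -lp0; exact/eqP.
  rewrite sc; have := up; rewrite lastI rcons_uniq -lp0 => /andP[h1 h2].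
  by rewrite h1.
- exact: mem_head.
Qed.

Lemma dicycle_map_tgt c : path.cycle (fun e f : edge G => tgt e == src f) c ->
  map (@tgt G) c = rot 1 (map (@src G) c).
Proof.
case: c => // e c; rewrite /= rot1_cons -map_rcons.
move: {1 3}e => f; elim: c f => [|h c IH] f /=; first by case/andP => /eqP ->.
by case/andP => /eqP -> /IH ->.
Qed.

(** The list of targets of a cycle is a rotation of its list of sources. *)
Lemma dicycle_balanced c : dicycle c -> balanced [set e in c]%SET.
Proof.
case/and3P => _ cyc /map_uniq uc w.
have card (f : edge G -> vert G) : #|[set e in c]%SET :&: [set e | f e == w]%SET| =
    count_mem w (map f c).
  rewrite count_map -size_filter -(card_uniqP (filter_uniq _ uc)).
  by apply: eq_card => e; rewrite !inE mem_filter andbC.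
rewrite !card dicycle_map_tgt //; apply/esym/permP.
by rewrite perm_rot.
Qed.

Lemma dicycle_mem_src c e : dicycle c -> e \in c ->
  (src e \in map (@src G) c) && (tgt e \in map (@src G) c).
Proof.
case/and3P => _ cyc _ ec; rewrite map_f //=.
by rewrite -(mem_rot 1) -dicycle_map_tgt // map_f.
Qed.

Lemma balanced_dicycle_at F e v : balanced F -> e \in F -> e \in inc v ->
  exists2 S, dicycle_at v S & S \subset F.
Proof.
move=> balF eF ev; have [c [dc ec cF]] := balanced_dicycle balF eF.
exists [set f in c]%SET; last by apply/fintype.subsetP => f; rewrite inE => /cF.
apply/asboolP; exists c; split=> //; have /andP[hs ht] := dicycle_mem_src dc ec.
by move: ev; rewrite !inE => /orP[/eqP <-|/eqP <-].
Qed.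

End Balanced.

(** * Counting integer polynomials of bounded size *)

Section SignedSums.
Variables (A : comNzRingType) (d : nat) (y : 'I_d -> A).

Definition ymon (m : 'I_d -> nat) : A := \prod_i y i ^+ m i.

(** Size is measured by the number [M] of signed monomials, repetitions allowed, because this bound
    is additive under sums and multiplicative under products. *)
Definition signed_sum (D M : nat) (a : A) : Prop :=
  exists l : seq (bool * {ffun 'I_d -> nat}),
    [/\ a = \sum_(t <- l) (-1) ^+ t.1 * ymon t.2, (size l <= M)%N &
        forall t, t \in l -> forall i, (t.2 i <= D)%N].

Lemma signed_sumW D M D' M' a : (D <= D')%N -> (M <= M')%N ->
  signed_sum D M a -> signed_sum D' M' a.
Proof.
move=> hD hM [l [-> sl el]]; exists l; split=> //; first exact: leq_trans hM.
by move=> t tl i; apply: leq_trans hD; exact: el.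
Qed.

Lemma signed_sum0 D : signed_sum D 0 0.
Proof. by exists [::]; rewrite big_nil; split. Qed.

Lemma signed_sum1 : signed_sum 0 1 1.
Proof.
exists [:: (false, [ffun=> 0%N])]; split=> //.
  rewrite big_seq1 /= expr0 mul1r /ymon big1 // => i _.
  by rewrite ffunE expr0.
by move=> t; rewrite inE => /eqP -> i; rewrite ffunE.
Qed.

Lemma signed_sumD D M N a b :
  signed_sum D M a -> signed_sum D N b -> signed_sum D (M + N) (a + b).
Proof.
move=> [l [-> sl el]] [k [-> sk ek]]; exists (l ++ k); split.
- by rewrite big_cat.
- by rewrite size_cat leq_add.
- by move=> t; rewrite mem_cat => /orP[/el|/ek].
Qed.

Lemma signed_sumN D M a : signed_sum D M a -> signed_sum D M (- a).
Proof.
move=> [l [-> sl el]]; exists [seq (~~ t.1, t.2) | t <- l]; split.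
- rewrite big_map -sumrN; apply: eq_bigr => t _ /=.
  by rewrite -mulNr; case: t.1; rewrite /= ?expr1 ?expr0 ?opprK.
- by rewrite size_map.
- by move=> _ /mapP[t tl ->] i; exact: (el t tl).
Qed.

Lemma signed_sumM D M D' M' a b : signed_sum D M a -> signed_sum D' M' b ->
  signed_sum (D + D') (M * M') (a * b).
Proof.
move=> [l [-> sl el]] [k [-> sk ek]].
pose term := (bool * {ffun 'I_d -> nat})%type.
pose mul (t u : term) : term := (t.1 (+) u.1, [ffun i => (t.2 i + u.2 i)%N]).
exists [seq mul t u | t <- l, u <- k]; split.
- rewrite big_allpairs_dep mulr_suml; apply: eq_bigr => t _ /=.
  rewrite mulr_sumr; apply: eq_bigr => u _ /=.
  rewrite signr_addb mulrACA /ymon -big_split; congr (_ * _).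
  by apply: eq_bigr => i _; rewrite ffunE exprD.
- by rewrite size_allpairs leq_mul.
- move=> _ /allpairsP[[t u] [/= tl uk ->]] i /=.
  by rewrite ffunE leq_add // ?(el t tl) ?(ek u uk).
Qed.

Lemma signed_sumX D M a k :
  signed_sum D M a -> signed_sum (k * D) (M ^ k) (a ^+ k).
Proof.
move=> ha; elim: k => [|k IH]; first by rewrite expr0 mul0n expn0; exact: signed_sum1.
by rewrite exprS expnS mulSn; exact: signed_sumM.
Qed.

Lemma signed_sum_gen i : signed_sum 1 1 (y i).
Proof.
exists [:: (false, [ffun j => (j == i) : nat])]; split=> //.
  rewrite big_seq1 /= expr0 mul1r /ymon (bigD1 i) //= ffunE eqxx expr1.
  rewrite big1 => [|j /negPf ne]; first by rewrite mulr1.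
  by rewrite ffunE ne expr0.
by move=> t; rewrite inE => /eqP -> j; rewrite ffunE leq_b1.
Qed.

Lemma signed_sum_sum D M N (F : 'I_N -> A) :
  (forall i, signed_sum D M (F i)) -> signed_sum D (N * M) (\sum_i F i).
Proof.
move=> hF; elim: N F hF => [|N IH] F hF.
  by rewrite big_ord0 mul0n; exact: signed_sum0.
by rewrite big_ord_recl mulSn; apply: signed_sumD => //; apply: IH => i; exact: hF.
Qed.

(** Collecting equal monomials gives coefficients between [-M] and [M]; shifted by [M] they live in
    a finite type, so that the possible values can be counted. *)
Lemma signed_sum_box D M a : signed_sum D M a ->
  exists c : {ffun {ffun 'I_d -> 'I_D.+1} -> 'I_(M.*2).+1},
    a = \sum_m ((c m)%:R - M%:R) * ymon (fun i => m i).
Proof.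
move=> [l [-> sl el]].
pose box (t : bool * {ffun 'I_d -> nat}) : {ffun 'I_d -> 'I_D.+1} :=
  [ffun i => inord (t.2 i)].
pose c m := (count (fun t => (box t == m) && ~~ t.1) l
  + (M - count (fun t => (box t == m) && t.1) l))%N.
have cle m : (c m < (M.*2).+1)%N.
  rewrite ltnS -addnn; apply: leq_add; last exact: leq_subr.
  by apply: leq_trans sl; exact: count_size.
exists [ffun m => Ordinal (cle m)].
rewrite (eq_big_seq (fun t : bool * {ffun 'I_d -> nat} =>
  (-1) ^+ t.1 * ymon (fun i => box t i))); last first.
  move=> t tl; congr (_ * _); apply: eq_bigr => i _.
  by rewrite ffunE inordK // ltnS; exact: (el t tl).
rewrite (partition_big box xpredT) //=; apply: eq_bigr => m _.
rewrite (eq_bigr (fun t : bool * {ffun 'I_d -> nat} =>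
  (-1) ^+ t.1 * ymon (fun i => m i))); last by move=> t /eqP ->.
rewrite -mulr_suml; congr (_ * _); rewrite ffunE /= /c natrD natrB; last first.
  by apply: leq_trans sl; exact: count_size.
rewrite addrA addrAC addrK => {cle c sl el}.
elim: l => [|t l IH]; first by rewrite big_nil subrr.
rewrite big_cons /= IH; case: (box t == m) => //=; case: t.1 => /=.
  by rewrite add0n expr1 natrD; ring.
by rewrite add0n expr0 natrD; ring.
Qed.

End SignedSums.

(* [ctree N n] encodes the polynomials in n variables, of degree less than N in
   each of them, with coefficients 0 and 1. *)
Fixpoint ctree (N n : nat) : finType :=
  if n is n'.+1 then {ffun 'I_N -> ctree N n'} : finType else bool : finType.

Fixpoint ctree_eval (A : comNzRingType) (N n : nat) :
    ctree N n -> (nat -> A) -> A :=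
  if n is n'.+1 return ctree N n -> (nat -> A) -> A then
    fun (f : {ffun 'I_N -> ctree N n'}) x =>
      \sum_(i < N) ctree_eval (f i) (x \o succn) * x 0%N ^+ i
  else fun (b : bool) _ => b%:R.

Lemma card_ctree N n : #|ctree N n| = (2 ^ (N ^ n))%N.
Proof.
elim: n => [|n IH]; first by rewrite card_bool.
by rewrite card_ffun card_ord IH -expnM expnSr.
Qed.

Lemma rmorph_ctree_eval (A B : comNzRingType) (h : {rmorphism A -> B}) N n
    (f : ctree N n) (x : nat -> A) :
  h (ctree_eval f x) = ctree_eval f (h \o x).
Proof.
elim: n f x => [|n IH] f x /=; first by rewrite rmorph_nat.
rewrite rmorph_sum; apply: eq_bigr => i _ /=.
by rewrite rmorphM rmorphXn IH.
Qed.

(** Each variable occurs with exponent below [N]: it adds at most [N * D] to the degree and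
    multiplies the number of terms by at most [N * M ^ N]. *)
Lemma signed_sum_ctree_eval (A : comNzRingType) d (y : 'I_d -> A) D M N n
    (f : ctree N n) (x : nat -> A) : (0 < M)%N ->
    (forall i, (i < n)%N -> signed_sum y D M (x i)) ->
  signed_sum y (n * (N * D)) ((N * M ^ N) ^ n) (ctree_eval f x).
Proof.
move=> M0; elim: n f x => [|n IH] f x hx /=.
  rewrite mul0n expn0; case: f => /=; first exact: signed_sum1.
  by apply: signed_sumW (signed_sum0 _ 0).
have -> : ((N * M ^ N) ^ n.+1 = N * ((N * M ^ N) ^ n * M ^ N))%N.
  by rewrite expnS -mulnA [(M ^ N * _)%N]mulnC.
apply: signed_sum_sum => i.
rewrite mulSn addnC.
apply: (@signed_sumW _ _ _ (n * (N * D) + i * D) ((N * M ^ N) ^ n * M ^ i)).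
- by rewrite leq_add2l leq_mul2r (ltnW (ltn_ord i)) orbT.
- by rewrite leq_mul2l leq_pexp2l ?orbT // ltnW.
- apply: signed_sumM; first by apply: IH => j hj; exact: (hx j.+1).
  by apply: signed_sumX; exact: (hx 0%N).
Qed.

Lemma leq_exp2r_weak m n e : (m <= n)%N -> (m ^ e <= n ^ e)%N.
Proof. by case: e => // e; rewrite leq_exp2r. Qed.

(* There are [2 ^ (N ^ d.+2)] trees, but their values are integer polynomials in
   the d generators whose degrees are linear in N and whose coefficients are
   bounded by an exponential in N, hence only [2 ^ O(N ^ d.+1)] of them. *)
Lemma ctree_pigeonhole (A : comNzRingType) d (y : 'I_d -> A) D M
    (n := d.+2) (x : nat -> A) :
    (forall i, (i < n)%N -> signed_sum y D M (x i)) ->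
  exists N (f g : ctree N n), f != g /\ ctree_eval f x = ctree_eval g x.
Proof.
move=> hx.
(* With a power of 2 as bound, all cardinals below are compared through their exponents. *)
have {}hx i : (i < n)%N -> signed_sum y D (2 ^ M) (x i).
  by move=> /hx; apply: signed_sumW => //; exact: ltnW (ltn_expl _ _).
(* There turn out to be at most [2 ^ (K * N ^ d.+1)] values, fewer than the [2 ^ (N ^ d.+2)] trees
   as soon as [K < N]. *)
pose K := ((2 + M.+1 * n) * (n * D).+1 ^ d)%N; pose N := K.+1; exists N.
apply: contrapT => inj_ev.
pose B := ((N * (2 ^ M) ^ N) ^ n)%N; pose D' := (n * (N * D))%N.
have /boolp.choice[c ec] : forall f : ctree N n, exists c :
    {ffun {ffun 'I_d -> 'I_D'.+1} -> 'I_(B.*2).+1},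
    ctree_eval f x = \sum_m ((c m)%:R - B%:R) * ymon y (fun i => m i).
  move=> f; apply: signed_sum_box; apply: signed_sum_ctree_eval => //.
  by rewrite expn_gt0.
have /leq_card : injective c.
  move=> f g e; apply/eqP; apply: contraT => ne; case: inj_ev.
  by exists f, g; split=> //; rewrite !ec e.
rewrite card_ctree !card_ffun !card_ord leqNgt => /negP; apply.
have N0 : (0 < N)%N by [].
have hB : ((B.*2).+1 <= 2 ^ ((2 + M.+1 * n) * N))%N.
  have : (B <= 2 ^ (M.+1 * n * N))%N.
    rewrite [X in (_ <= 2 ^ X)%N]mulnAC expnM leq_exp2r // mulSn expnD.
    by rewrite expnM leq_mul // ltnW // ltn_expl.
  have : (0 < 2 ^ (M.+1 * n * N))%N by rewrite expn_gt0.
  set u := (2 ^ _)%N => u0 hB.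
  apply: (@leq_trans (4 * u)); first by rewrite -addnn; lia.
  rewrite /u (_ : 4 = 2 ^ 2)%N // -expnD leq_exp2l // mulnDl leq_add2r.
  by rewrite leq_pmulr.
have hD : (D'.+1 ^ d <= ((n * D).+1 * N) ^ d)%N.
  apply: leq_exp2r_weak; rewrite mulSn /D'; nia.
apply: (@leq_ltn_trans ((2 ^ ((2 + M.+1 * n) * N)) ^ (((n * D).+1 * N) ^ d))).
  apply: leq_trans (leq_exp2r_weak _ hB).
  by rewrite leq_pexp2l.
rewrite -expnM ltn_exp2l // expnMn.
have -> : ((2 + M.+1 * n) * N * ((n * D).+1 ^ d * N ^ d) = K * N ^ d.+1)%N.
  by rewrite /K expnS; ring.
by rewrite [X in (_ < X)%N]expnS ltn_pmul2r // expn_gt0.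
Qed.

(** * Bounding chains of primes by polynomial relations *)

Lemma prime_idealN (A : comPzRingType) (P : set A) a :
  prime_ideal P -> P a -> P (- a).
Proof. by case=> _ _ PM _ _ Pa; rewrite -mulN1r; exact: PM. Qed.

Lemma prime_ideal_expr (A : comNzRingType) (P : set A) (x : A) n :
  prime_ideal P -> P (x ^+ n) -> P x.
Proof.
move=> prP; elim: n => [|n IH]; first by rewrite expr0; case: prP => _ _ _ h _ /h.
by rewrite exprS; case: prP => _ _ _ _ h /h[|/IH].
Qed.

Lemma prime_ideal_ker (A : comNzRingType) (D : idomainType) (h : {rmorphism A -> D}) :
  prime_ideal (fun x => h x = 0).
Proof.
split; first exact: rmorph0.
- by move=> x y hx hy; rewrite rmorphD hx hy addr0.
- by move=> a x hx; rewrite rmorphM hx mulr0.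
- by rewrite rmorph1; apply/eqP/oner_neq0.
- move=> x y /eqP; rewrite rmorphM mulf_eq0 => /orP[/eqP|/eqP]; [left|right] => //.
Qed.

Section Peeling.
Variable A : comNzRingType.
Implicit Types (P Q : set A) (x : nat -> A).

(* Divide a nonzero polynomial relation by the highest possible power of the
   first variable and then set that variable to zero. *)
Lemma ctree_peel P Q x N n (f g : ctree N n.+1) :
    prime_ideal P -> prime_ideal Q -> (P `<=` Q)%classic ->
    ~ P (x 0%N) -> Q (x 0%N) ->
    f != g -> P (ctree_eval f x - ctree_eval g x) ->
  exists f' g' : ctree N n, f' != g' /\
    Q (ctree_eval f' (x \o succn) - ctree_eval g' (x \o succn)).
Proof.
move: f g => /= f g prP prQ PQ nPx Qx ne.
have [i0 ni0] : exists i, f i != g i.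
  apply: contrapT => /forallNP h; move/eqP: ne; apply; apply/ffunP => i.
  by apply/eqP; apply: contrapT => /negP; exact: h.
case: (@arg_minnP _ i0 (fun i => f i != g i) (fun i : 'I_N => i : nat) ni0) => i ni imin.
pose c j := ctree_eval (f j) (x \o succn) - ctree_eval (g j) (x \o succn).
have -> : \sum_(j < N) ctree_eval (f j) (x \o succn) * x 0%N ^+ j -
    \sum_(j < N) ctree_eval (g j) (x \o succn) * x 0%N ^+ j =
    x 0%N ^+ i * (c i + x 0%N * \sum_(j < N | (i < j)%N) c j * x 0%N ^+ (j - i.+1)).
  rewrite -sumrB (eq_bigr (fun j : 'I_N => c j * x 0%N ^+ j)); last first.
    by move=> j _; rewrite mulrBl.
  rewrite (bigID (fun j : 'I_N => (j < i)%N)) /= big1 ?add0r; last first.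
    move=> j ltji; rewrite /c; have [->|nj] := eqVneq (f j) (g j).
      by rewrite subrr mul0r.
    by have := imin j nj; rewrite leqNgt ltji.
  rewrite (bigD1 i) ?ltnn //= mulrDr mulrC; congr (_ + _).
  rewrite mulrA -exprSr mulr_sumr; apply: eq_big => [j|j].
    by rewrite -leqNgt ltn_neqAle andbC eq_sym.
  rewrite -leqNgt => /andP[le_ij nij].
  have lt_ij : (i < j)%N by rewrite ltn_neqAle le_ij andbT eq_sym.
  by rewrite mulrCA -exprD subnKC.
(* As [P] is prime and misses [x 0], the cofactor of the power lies in [P], hence in [Q]; its
   multiples of [x 0] lie in [Q], so its constant coefficient [c i] does too. *)
case: (prP) => _ _ _ _ h /h {h}[/(prime_ideal_expr prP) //|h].
exists (f i), (g i); split=> //; rewrite -/(c i).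
have -> : c i = (c i + x 0%N * \sum_(j < N | (i < j)%N) c j * x 0%N ^+ (j - i.+1)) -
   (\sum_(j < N | (i < j)%N) c j * x 0%N ^+ (j - i.+1)) * x 0%N.
  by rewrite [x 0%N * _]mulrC addrK.
case: (prQ) => _ QD QM _ _; apply: QD; first exact: PQ.
by apply: prime_idealN => //; exact: QM.
Qed.

Lemma ctree_peel_chain (P : nat -> set A) N n k x (f g : ctree N (n + k)) :
    (forall i, (i <= n)%N -> prime_ideal (P i)) ->
    (forall i, (i < n)%N -> (P i `<=` P i.+1)%classic) ->
    (forall i, (i < n)%N -> P i.+1 (x i) /\ ~ P i (x i)) ->
    f != g -> P 0%N (ctree_eval f x - ctree_eval g x) ->
  exists f' g' : ctree N k, f' != g' /\
    P n (ctree_eval f' (fun i => x (n + i)%N) - ctree_eval g' (fun i => x (n + i)%N)).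
Proof.
elim: n P x f g => [|n IH] P x f g prP subP hx ne Pfg; first by exists f, g.
have [P1x P0x] := hx 0%N isT.
have [f' [g' [ne' Pfg']]] := ctree_peel (prP 0%N isT) (prP 1%N isT) (subP 0%N isT)
  P0x P1x ne Pfg.
exact: (IH (P \o succn) (x \o succn) f' g' (fun i => prP i.+1)
  (fun i => subP i.+1) (fun i => hx i.+1) ne' Pfg').
Qed.

End Peeling.

Section Dimension.
Variables (A : comNzRingType) (d : nat) (y : 'I_d -> A).

Definition int_poly_in (a : A) : Prop := exists D M, signed_sum y D M a.

Variables (P : nat -> set A) (n : nat).
Hypothesis prP : forall i, (i <= n)%N -> prime_ideal (P i).
Hypothesis ltP : forall i, (i < n)%N -> (P i `<` P i.+1)%classic.
(** The factor [u] is a denominator: it is 1 over the integers and a positive integer over the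
    rationals. *)
Hypothesis genP : forall p, exists u q, [/\ forall i, (i <= n)%N -> ~ P i u,
  int_poly_in q & P 0%N (u * p - q)].

Let leP i j : (i <= j)%N -> (j <= n)%N -> (P i `<=` P j)%classic.
Proof.
elim: j => [|j IH]; first by rewrite leqn0 => /eqP -> _ a.
rewrite leq_eqVlt => /predU1P[-> _ a //|]; rewrite ltnS => leij ltjn a Pa.
by apply: (properW (ltP ltjn)); apply: IH Pa => //; exact: ltnW.
Qed.

(** An element of [P i.+1] outside [P i] stays so when multiplied by [u], which both primes avoid,
    and when changed modulo [P 0]; this turns it into an integer polynomial in the generators. *)
Let choose_x : exists x : nat -> A, forall i, (i < n)%N ->
  [/\ P i.+1 (x i), ~ P i (x i) & int_poly_in (x i)].
Proof.
suff : forall i, exists a, (i < n)%N -> [/\ P i.+1 a, ~ P i a & int_poly_in a].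
  by move=> /boolp.choice[x hx]; exists x.
move=> i; have [ltin|leni] := ltnP i n; last by exists 0.
have [p [Pp nPp]] : exists p, P i.+1 p /\ ~ P i p.
  apply: contrapT => /forallNP h; case: (ltP ltin) => _; apply => a Pa.
  by apply: contrapT => nPa; exact: (h a).
have [u [q [nPu yq Puq]]] := genP p.
exists q => _; have P0 := leP (leq0n _).
have Puqi j : (j <= n)%N -> P j (u * p - q) by move=> /P0; apply.
have prS := prP ltin; have prI := prP (ltnW ltin).
split=> //.
  rewrite -[q](subKr (u * p)); case: (prS) => _ PD PM _ _.
  by apply: PD; [exact: PM | exact: (prime_idealN prS (Puqi _ ltin))].
move=> Pq; case: (prI) => _ PD _ _ pr.
have : P i (u * p) by rewrite -[u * p](subrK q); apply: PD => //; exact/Puqi/ltnW.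
by move=> /pr[/nPu|//]; apply; exact: ltnW.
Qed.

Let relation (x : nat -> A) : (forall i, (i < d.+2)%N -> int_poly_in (x i)) ->
  exists N (f g : ctree N d.+2), f != g /\ ctree_eval f x = ctree_eval g x.
Proof.
move=> hx.
have [D hD] : exists D : 'I_d.+2 -> nat, forall i, exists M, signed_sum y (D i) M (x i).
  have /boolp.choice[D hD] : forall i : 'I_d.+2, exists D M, signed_sum y D M (x i).
    by move=> i; exact: hx.
  by exists D.
have [M hM] := boolp.choice hD.
apply: (@ctree_pigeonhole _ d y (\max_i D i) (\max_i M i)) => i lti.
apply: signed_sumW (hM (Ordinal lti)); exact: leq_bigmax.
Qed.

(** Along [d.+2] strict inclusions all variables of a relation are peeled off, and the constants 0
    and 1 would become equal modulo a proper ideal. *)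
Lemma chain_bound : (n <= d.+1)%N.
Proof.
rewrite leqNgt; apply/negP => ltn.
have [x hx] := choose_x.
have [|N [f [g [ne e]]]] := @relation x.
  by move=> i lti; have [] := hx i (leq_trans lti ltn).
rewrite -[d.+2]addn0 in f g ne e.
have [|||| f' [g' [ne' Pfg]]] := @ctree_peel_chain _ P N d.+2 0 x f g _ _ _ ne.
- by move=> i lei; exact: (prP (leq_trans lei ltn)).
- by move=> i lti; exact: (properW (ltP (leq_trans lti ltn))).
- by move=> i lti; have [] := hx i (leq_trans lti ltn).
- by rewrite e subrr; case: (prP (leq0n _)).
case: (prP ltn) => _ _ PM nP1 _; apply: nP1.
move: f' g' ne' Pfg => /= -[] [] //= _; rewrite ?subr0 ?sub0r //.
by move=> /(PM (-1)); rewrite mulrNN mulr1.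
Qed.

(* The element 2 plays the role of an extra variable: a nonzero polynomial with
   coefficients 0, 1 and -1 does not vanish at 2. *)
Lemma chain_bound_char0 : (forall m, (0 < m)%N -> ~ P n m%:R) -> (n <= d)%N.
Proof.
move=> char0; rewrite leqNgt; apply/negP => ltn.
have [x hx] := choose_x.
pose x2 i := if (i < d.+1)%N then x i else 2.
have [|N [f [g [ne e]]]] := @relation x2.
  move=> i; rewrite /x2 ltnS leq_eqVlt => /predU1P[->|lti].
    rewrite ltnn; exists 0%N, 2%N.
    by have := signed_sumD (signed_sum1 y) (signed_sum1 y).
  by rewrite lti; have [] := hx i (leq_trans lti ltn).
rewrite -[d.+2]addn1 in f g ne e.
have [|||| f' [g' [ne' Pfg]]] := @ctree_peel_chain _ P N d.+1 1 x2 f g _ _ _ ne.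
- by move=> i lei; exact: (prP (leq_trans lei ltn)).
- by move=> i lti; exact: (properW (ltP (leq_trans lti ltn))).
- by move=> i lti; rewrite /x2 lti; have [] := hx i (leq_trans lti ltn).
- by rewrite e subrr; case: (prP (leq0n _)).
have x2E : (fun i => x2 (d.+1 + i)%N) = intr \o (fun=> 2 : int).
  by apply/funext => i /=; rewrite /x2 ltnNge leq_addr.
move: Pfg; rewrite x2E -!(rmorph_ctree_eval (intr : {rmorphism int -> A})) -rmorphB.
set z : int := _ - _ => Pz.
have z0 : z = 0.
  apply: contrapT => nz; case: z nz Pz => m nz Pz.
    have m0 : (0 < m)%N by rewrite lt0n; apply/eqP => m0; apply: nz; rewrite m0.
    by apply: (char0 m m0); apply: leP Pz.
  apply: (char0 m.+1 (ltn0Sn m)); apply: (leP ltn (leqnn n)).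
  by have := prime_idealN (prP ltn) Pz; rewrite NegzE rmorphN opprK.
(* One more peeling, along the primes 0 and (2) of [int], excludes a relation satisfied by 2. *)
have [|||f2 [g2 [ne2]]] := @ctree_peel _ _ _ (fun=> 2 : int) N 0 f' g'
  (prime_ideal_ker (idfun : {rmorphism int -> int}))
  (prime_ideal_ker (intr : {rmorphism int -> 'F_2})) _ _ _ ne' z0.
- by move=> a /= ->; rewrite rmorph0.
- by [].
- by apply/val_inj.
- by case: f2 g2 ne2 => -[] //= _ /eqP; rewrite ?subr0 ?sub0r ?rmorphN rmorph1.
Qed.

End Dimension.

(** * Disjoint cycles and edge cuts at a vertex *)

Section AlphaBeta.
Variables (G : digraph) (v : vert G).

Lemma dicycle_at_edge S : dicycle_at v S -> exists2 e, e \in S & e \in inc v.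
Proof.
move=> /asboolP[c [_ /mapP[e ec ->] ->]]; exists e; first by rewrite inE.
by rewrite !inE eqxx.
Qed.

Lemma dicycle_at_balanced S : dicycle_at v S -> balanced S.
Proof. by move=> /asboolP[c [dc _ ->]]; exact: dicycle_balanced. Qed.

Lemma alpha_geq d (S : 'I_d -> {set edge G}) :
    (forall i, dicycle_at v (S i)) ->
    (forall i j, i != j -> [disjoint S i & S j]) ->
  (d <= alpha v)%N.
Proof.
move=> cycS disjS.
have injS : injective S.
  move=> i j eS; apply/eqP; apply: contraT => /disjS; rewrite eS.
  have [e ej _] := dicycle_at_edge (cycS j).
  by move/pred0P => /(_ e); rewrite /= ej.
rewrite -[d]card_ord -(card_imset _ injS).
apply: leq_bigmax_cond; apply/andP; split.
  apply/finset.trivIsetP => _ _ /imsetP[i _ ->] /imsetP[j _ ->] ne.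
  by apply: disjS; apply: contraNneq ne => ->.
by apply/forallP => T; apply/implyP => /imsetP[i _ ->].
Qed.

Lemma alpha_attained : exists S : 'I_(alpha v) -> {set edge G},
  (forall i, dicycle_at v (S i)) /\
  (forall i j, i != j -> [disjoint S i & S j]).
Proof.
pose adm (P : {set {set edge G}}) :=
  finset.trivIset P && [forall S in P, dicycle_at v S].
have adm0 : adm finset.set0.
  apply/andP; split; last by apply/forallP => T; rewrite inE.
  by apply/finset.trivIsetP => A B; rewrite inE.
have [|P admP eP] := @eq_bigmax_cond _ adm (fun P => #|P|).
  by apply/card_gt0P; exists finset.set0.
have -> : alpha v = #|P| by rewrite -eP.
have /andP[/finset.trivIsetP triP /forallP cycP] := admP.
exists (fun i => enum_val i); split=> [i|i j ne].
  by have := cycP (enum_val i); rewrite enum_valP.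
by apply: triP (enum_valP i) (enum_valP j) _; rewrite (inj_eq enum_val_inj).
Qed.

(** A destroying set meets each cycle of a maximal disjoint family, and in different edges. *)
Lemma alpha_le_beta : (alpha v <= beta v)%N.
Proof.
have [S [cycS disjS]] := alpha_attained.
rewrite /beta; case: arg_minnP => [|F /andP[_ desF] _].
  by rewrite subxx destroys_inc.
have /boolp.choice[f fP] : forall i, exists e, e \in S i :&: F.
  move=> i; move/forallP/(_ (S i)): desF; rewrite cycS /= => /pred0Pn[e /=].
  by move=> he; exists e; rewrite inE.
have injf : injective f.
  move=> i j ef; apply/eqP; apply: contraT => /disjS /pred0P /(_ (f i)) /=.
  have := fP i; rewrite inE => /andP[-> _].
  by have := fP j; rewrite inE ef => /andP[-> _].
rewrite -[X in (X <= _)%N]card_ord -(card_imset _ injf); apply: subset_leq_card.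
by apply/fintype.subsetP => _ /imsetP[i _ ->]; have := fP i; rewrite inE => /andP[].
Qed.

Section NoCycle.
Hypothesis acyc : forall c : seq (edge G), dicycle c -> v \notin map (@src G) c.

Lemma acyclic_dicycle_at S : ~~ dicycle_at v S.
Proof. by apply/asboolP => -[c [/acyc/negP h /h]]. Qed.

Lemma acyclic_beta : beta v = 0%N.
Proof.
rewrite /beta; case: arg_minnP => [|F _ minF]; first by rewrite subxx destroys_inc.
apply/eqP; rewrite -leqn0 -(cards0 (edge G)); apply: minF.
rewrite finset.sub0set; apply/forallP => S; by rewrite (negPf (acyclic_dicycle_at S)).
Qed.

End NoCycle.

Lemma dicycle_alpha c : dicycle c -> v \in map (@src G) c -> (0 < alpha v)%N.
Proof.
move=> dc vc; apply: (@alpha_geq 1 (fun=> [set e in c]%SET)).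
  by move=> _; apply/asboolP; exists c.
by move=> i j; rewrite !ord1.
Qed.

End AlphaBeta.

(** * Prime chains and Krull dimension of a quotient *)

Section QuotientPrimes.
Variables (A : comPzRingType) (J : submodule A^o).
Local Notation pi := (rquot_pi J).

Lemma rquot_pi_eq0 x : pi x = 0 <-> (x : A^o) \in J.
Proof. exact: lquot_pi_eq0. Qed.

Lemma rquot_piM x y : pi (x * y) = pi x * pi y.
Proof. by rewrite -rquot_pi_mul. Qed.

Lemma rquot_pi1 : pi 1 = 1. Proof. by []. Qed.

Lemma rquot_pi0 : pi 0 = 0.
Proof. by apply/rquot_pi_eq0; exact: rpred0. Qed.

Lemma rquot_repr_piB x : (rquot_repr (pi x) - x : A^o) \in J.
Proof. by apply/lquot_piP; exact: (rquot_reprK (pi x)). Qed.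

(** The correspondence between the primes of a quotient and the primes containing [J]. In the
    backward direction membership is tested on a representative, which is harmless as [P i] contains
    [J]. *)
Lemma prime_chain_rquot n :
  prime_chain (rquot J) n <->
  exists P : nat -> set A,
    [/\ forall i, (i <= n)%N -> prime_ideal (P i),
        forall i, (i < n)%N -> (P i `<` P i.+1)%classic &
        forall i, (i <= n)%N -> forall x, (x : A^o) \in J -> P i x].
Proof.
split=> [[P [prP ltP]]|[P [prP ltP JP]]].
  exists (fun i => fun x => P i (pi x)); split.
  - move=> i /prP[P0 PD PM P1 pr]; split=> //.
    + by rewrite rquot_pi0.
    + by move=> x y; rewrite rquot_piD; exact: PD.
    + by move=> a x; rewrite rquot_piM; exact: PM.
    + by move=> x y; rewrite rquot_piM; exact: pr.
  - move=> i /ltP[sub nsub]; split=> [x|h]; first exact: sub.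
    by apply: nsub => q; rewrite -(rquot_reprK q); exact: h.
  - by move=> i /prP[P0 _ _ _ _] x /rquot_pi_eq0 ->.
have mem_repr i x : (i <= n)%N -> P i (rquot_repr (pi x)) <-> P i x.
  move=> lei; have h := JP i lei _ (rquot_repr_piB x).
  have [_ PD _ _ _] := prP i lei; split=> Px.
    rewrite -[x](subKr (rquot_repr (pi x))); apply: PD => //.
    by apply: prime_idealN => //; exact: prP.
  by rewrite -(subrK x (rquot_repr (pi x))); apply: PD.
exists (fun i => fun q => P i (rquot_repr q)); split.
  move=> i lei; have [P0 PD PM P1 pr] := prP i lei; split.
  - by rewrite -rquot_pi0; apply/mem_repr.
  - move=> p q Pp Pq; rewrite -(rquot_reprK p) -(rquot_reprK q) -rquot_piD.
    by apply/mem_repr => //; exact: PD.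
  - move=> p q Pq; rewrite -(rquot_reprK p) -(rquot_reprK q) -rquot_piM.
    by apply/mem_repr => //; exact: PM.
  - by rewrite -rquot_pi1 => /(mem_repr _ _ lei).
  - move=> p q; rewrite -{1}(rquot_reprK p) -{1}(rquot_reprK q) -rquot_piM.
    by move=> /(mem_repr _ _ lei)/pr.
move=> i lti; have [sub nsub] := ltP i lti; split=> [q|h]; first exact: sub.
apply: nsub => x Px; apply/mem_repr; first exact: ltnW.
by apply: h; apply/mem_repr.
Qed.

End QuotientPrimes.

(** [supremum] is a chosen value, so a maximum is identified with it by uniqueness of suprema. *)
Lemma krull_dim_eq (A : comPzRingType) (d : nat) :
  prime_chain A d -> (forall n, prime_chain A n -> (n <= d)%N) ->
  krull_dim A = d%:Z%:E.
Proof.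
move=> chain_d max_d.
have sup_d : supremums [set n%:Z%:E | n in prime_chain A]%classic (d%:Z%:E : \bar int).
  split=> [_ [n chain_n <-]|u]; last by apply; exists d.
  by rewrite lee_fin lez_nat; exact: max_d.
rewrite /krull_dim /supremum; case: ifPn => [/eqP e|_].
  have : [set n%:Z%:E | n in prime_chain A]%classic (d%:Z%:E : \bar int) by exists d.
  by rewrite [X in X _]e.
case: xgetP => [x _ sup_x|/(_ _ sup_d) //].
exact: (is_subset1_supremums sup_x sup_d).
Qed.

(** * Morphisms from polynomial rings and integer polynomials in their values *)

Lemma eq_mpoly_rmorph (F : comNzRingType) (n : nat) (B : comNzRingType)
    (f g : {rmorphism {mpoly F[n]} -> B}) :
    (forall c, f c%:MP = g c%:MP) -> (forall i, f 'X_i = g 'X_i) ->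
  f =1 g.
Proof.
move=> eqC eqX; apply: mpolyind => [|c m p _ _ IH]; first by rewrite !rmorph0.
rewrite -mul_mpolyC !rmorphD !rmorphM IH eqC mpolyXE_id !rmorph_prod; congr (_ * _ + _).
by apply: eq_bigr => i _; rewrite !rmorphXn eqX.
Qed.

Lemma poly_sub_pvar (F : comNzRingType) (T : finType) (S : {set T}) (t : {t | t \in S}) :
  poly_sub F S (pvar F t) = pvar F (val t).
Proof.
by rewrite /poly_sub /pvar /= comp_mpolyXU -tnth_nth tnth_mktuple enum_rankK.
Qed.

Lemma poly_subC (F : comNzRingType) (T : finType) (S : {set T}) (c : F) :
  poly_sub F S c%:MP = c%:MP.
Proof. exact: comp_mpolyC. Qed.

Lemma pvar_enum_val (F : comNzRingType) (T : finType) (i : 'I_#|{: T}|) :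
  'X_i = pvar F (enum_val i).
Proof. by rewrite /pvar enum_valK. Qed.

Section IntPoly.
Variables (A : comNzRingType) (d : nat) (y : 'I_d -> A).

Lemma int_poly_inD a b :
  int_poly_in y a -> int_poly_in y b -> int_poly_in y (a + b).
Proof.
move=> [D [M ha]] [D' [M' hb]]; exists (maxn D D'), (M + M')%N.
by apply: signed_sumD; [apply: signed_sumW ha|apply: signed_sumW hb];
  rewrite ?leq_maxl ?leq_maxr.
Qed.

Lemma int_poly_inM a b :
  int_poly_in y a -> int_poly_in y b -> int_poly_in y (a * b).
Proof.
move=> [D [M ha]] [D' [M' hb]]; exists (D + D')%N, (M * M')%N.
exact: signed_sumM.
Qed.

Lemma int_poly_in1 : int_poly_in y 1.
Proof. by exists 0%N, 1%N; exact: signed_sum1. Qed.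

Lemma int_poly_in_gen i : int_poly_in y (y i).
Proof. by exists 1%N, 1%N; exact: signed_sum_gen. Qed.

Lemma int_poly_in_int (m : int) : int_poly_in y m%:~R.
Proof.
have nat_in k : int_poly_in y k%:R.
  elim: k => [|k IH]; first by exists 0%N, 0%N; exact: signed_sum0.
  by rewrite -addn1 natrD; apply: int_poly_inD => //; exact: int_poly_in1.
case: m => m; first exact: nat_in.
have [D [M h]] := nat_in m.+1.
by exists D, M; rewrite NegzE rmorphN; apply: signed_sumN.
Qed.

Lemma int_poly_inX a k : int_poly_in y a -> int_poly_in y (a ^+ k).
Proof.
move=> ha; elim: k => [|k IH]; first by rewrite expr0; exact: int_poly_in1.
by rewrite exprS; exact: int_poly_inM.
Qed.

Lemma int_poly_in_mpoly (F : comNzRingType) (n : nat) (den : set nat)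
    (h : {rmorphism {mpoly F[n]} -> A}) :
    den 1%N -> (forall k l, den k -> den l -> den (k * l)%N) ->
    (forall c : F, exists k (m : int), den k /\ k%:R * c = m%:~R) ->
    (forall i, h 'X_i = 0 \/ exists j, h 'X_i = y j) ->
  forall p, exists k, den k /\ int_poly_in y (k%:R * h p).
Proof.
move=> den1 denM denF hX; apply: mpolyind => [|c m p _ _ [k [dk hp]]].
  by exists 1%N; split=> //; rewrite rmorph0 mulr0; exact: (int_poly_in_int 0).
have [l [z [dl e]]] := denF c.
have hm : int_poly_in y (h 'X_[m]).
  rewrite mpolyXE_id rmorph_prod; elim/big_ind: _ => [|a b|i _].
  - exact: int_poly_in1.
  - exact: int_poly_inM.
  - rewrite rmorphXn; apply: int_poly_inX.
    case: (hX i) => [->|[j ->]]; [exact: (int_poly_in_int 0)|exact: int_poly_in_gen].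
have lc : l%:R * h c%:MP = z%:~R.
  have -> : l%:R * h c%:MP = h (l%:R * c)%:MP by rewrite mpolyCM rmorphM !rmorph_nat.
  by rewrite e !rmorph_int.
exists (k * l)%N; split; first exact: denM.
have -> : (k * l)%:R * h (c *: 'X_[m] + p) =
    k%:Z%:~R * (z%:~R * h 'X_[m]) + l%:Z%:~R * (k%:R * h p).
  rewrite natrM -lc rmorphD -mul_mpolyC [h (_ * _)]rmorphM !pmulrn; ring.
apply: int_poly_inD; apply: int_poly_inM => //; try exact: int_poly_in_int.
by apply: int_poly_inM => //; exact: int_poly_in_int.
Qed.

End IntPoly.

(** * Lower bound: independent labels on disjoint cycles *)

Section DisjointCycles.
Variables (G : digraph) (v : vert G) (d : nat) (S : 'I_d -> {set edge G}).
Hypothesis cycS : forall i, dicycle_at v (S i).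
Hypothesis disjS : forall i j, i != j -> [disjoint S i & S j].
Variable F : idomainType.
Variable phi : {rmorphism polyT int (edge G) -> polyT F (edge G)}.
Hypothesis phi_pvar : forall e, phi (pvar int e) = pvar F e.

(** The sum avoids choosing a cycle through [e]; by disjointness at most one term is nonzero. *)
Definition cycle_label (e : edge G) : {mpoly F[d]} :=
  \sum_(j < d) (if e \in S j then 'X_j else 0).

Definition label_hom : {rmorphism polyT F (edge G) -> {mpoly F[d]}} :=
  comp_mpoly [tuple cycle_label (enum_val i) | i < #|{: edge G}|].

Lemma label_hom_pvar e : label_hom (pvar F e) = cycle_label e.
Proof.
by rewrite /label_hom /pvar /= comp_mpolyXU -tnth_nth tnth_mktuple enum_rankK.
Qed.

Lemma label_homC c : label_hom c%:MP = c%:MP.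
Proof. exact: comp_mpolyC. Qed.

Lemma cycle_label_mem e j : e \in S j -> cycle_label e = 'X_j.
Proof.
move=> ej; rewrite /cycle_label (bigD1 j) //= ej big1 ?addr0 // => k ne.
by have /pred0P/(_ e) := disjS ne; rewrite /= ej andbT => ->.
Qed.

(** Grouped by cycles, the product depends on [T] only through the number of its edges on each
    cycle, so balance of the cycles yields the equations of [Delta G]. *)
Lemma gen_poly_cycle_label (T : {set edge G}) : gen_poly cycle_label T =
  \prod_(j < d) (1 + 'X_j *: 'X) ^+ #|S j :&: T|.
Proof.
transitivity (\prod_(e in T) \prod_(j < d) (if e \in S j then 1 + 'X_j *: 'X else 1)
  : {poly {mpoly F[d]}}).
  apply: eq_bigr => e _; case: (pickP (fun j => e \in S j)) => [j ej|none].
    rewrite (cycle_label_mem ej) (bigD1 j) //= ej big1 ?mulr1 // => k ne.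
    by have /pred0P/(_ e) := disjS ne; rewrite /= ej andbT => ->.
  rewrite /cycle_label !big1 ?scale0r ?addr0 // => j _; by rewrite none.
rewrite exchange_big; apply: eq_bigr => j _ /=.
rewrite -big_mkcondr -prodr_const; apply: eq_bigl => e.
by rewrite inE andbC.
Qed.

Lemma label_hom_Delta p : in_ideal (map phi (Delta G)) p -> label_hom p = 0.
Proof.
move: p; apply: (in_ideal_min (J := fun p => label_hom p = 0)).
- exact: rmorph0.
- by move=> a b ha hb; rewrite rmorphD ha hb addr0.
- by move=> a b hb; rewrite rmorphM hb mulr0.
move=> _ /mapP[q qD ->]; move: q qD.
apply/(rmorph_Delta (label_hom \o phi)) => w.
have lab : (fun e => (label_hom \o phi) (pvar int e)) = cycle_label.
  by apply/funext => e /=; rewrite phi_pvar label_hom_pvar.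
rewrite lab !gen_poly_cycle_label; apply: eq_bigr => j _.
by rewrite (dicycle_at_balanced (cycS j)).
Qed.

(** The quotient by the first [i] variables, realised as an endomorphism so that all the primes of
    the chain are kernels into one domain. *)
Definition kill_below (i : nat) : {rmorphism {mpoly F[d]} -> {mpoly F[d]}} :=
  comp_mpoly [tuple if (j < i)%N then 0 else 'X_j | j < d].

Lemma kill_below_X i j : kill_below i 'X_j = if (j < i)%N then 0 else 'X_j.
Proof. by rewrite /kill_below /= comp_mpolyXU -tnth_nth tnth_mktuple. Qed.

Lemma kill_belowC i c : kill_below i c%:MP = c%:MP.
Proof. exact: comp_mpolyC. Qed.

Lemma kill_below_comp i p : kill_below i.+1 (kill_below i p) = kill_below i.+1 p.
Proof.
apply: (eq_mpoly_rmorph (f := kill_below i.+1 \o kill_below i)) => [c|j] /=.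
  by rewrite !kill_belowC.
rewrite !kill_below_X; case: ltnP => [lt|_]; last by rewrite kill_below_X.
by rewrite rmorph0 ltnS ltnW.
Qed.

Local Notation A := (polyT F {e | e \in inc v}).
Local Notation iota := (poly_sub F (inc v)).

Definition cycle_prime (i : nat) : set A :=
  fun a => kill_below i (label_hom (iota a)) = 0.

Lemma cycle_prime_prime i : prime_ideal (cycle_prime i).
Proof. exact: (prime_ideal_ker (kill_below i \o (label_hom \o iota))). Qed.

(** The [i]-th cycle passes through [v], so one of its edges has its variable in the small ring; its
    label is killed at stage [i.+1] but not at stage [i]. *)
Lemma cycle_prime_lt i : (i < d)%N -> (cycle_prime i `<` cycle_prime i.+1)%classic.
Proof.
move=> ltid; split=> [a|sub].
  by rewrite /cycle_prime => ha; rewrite -kill_below_comp ha rmorph0.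
have [e eS ev] := dicycle_at_edge (cycS (Ordinal ltid)).
have eE k : kill_below k (label_hom (iota (pvar F (exist _ e ev)))) =
    if (i < k)%N then 0 else 'X_(Ordinal ltid).
  by rewrite poly_sub_pvar label_hom_pvar (cycle_label_mem eS) kill_below_X.
have := sub (pvar F (exist _ e ev)); rewrite /cycle_prime !eE ltnSn ltnn => /(_ erefl).
move/(congr1 (mcoeff U_(Ordinal ltid))); rewrite mcoeffX eqxx mcoeff0 => /eqP.
by rewrite oner_eq0.
Qed.

Lemma cycle_prime_ideal i a :
  in_ideal (map phi (Delta G)) (iota a) -> cycle_prime i a.
Proof. by move=> /label_hom_Delta h; rewrite /cycle_prime h rmorph0. Qed.

Lemma cycle_prime_const i c : cycle_prime i c%:MP -> c = 0.
Proof.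
rewrite /cycle_prime poly_subC label_homC kill_belowC.
by move/eqP; rewrite mpolyC_eq0 => /eqP.
Qed.

(** Once all variables are killed only the constant term remains. Over the integers this leaves room
    for one further prime, by reduction modulo 2. *)
Lemma cycle_prime_meval a : cycle_prime d a ->
  (label_hom (iota a)).@[fun=> 0] = 0.
Proof.
have meval_kill p : p.@[fun=> 0] = (kill_below d p).@[fun=> 0].
  apply: (eq_mpoly_rmorph (f := meval (fun=> 0))
    (g := meval (fun=> 0) \o kill_below d)) => [c|j].
    by rewrite -[RHS]/((kill_below d c%:MP).@[_]) kill_belowC.
  rewrite -[RHS]/((kill_below d 'X_j).@[_]) kill_below_X ltn_ord [RHS]meval0.
  exact: mevalXU.
by rewrite /cycle_prime meval_kill => ->; rewrite meval0.
Qed.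

End DisjointCycles.

(** * Upper bound: few distinct labels at the vertex *)

Section UpperBound.
Variables (G : digraph) (v : vert G) (F : comNzRingType).
Variable phi : {rmorphism polyT int (edge G) -> polyT F (edge G)}.
Hypothesis phi_pvar : forall e, phi (pvar int e) = pvar F e.
Local Notation A := (polyT F {e | e \in inc v}).
Local Notation iota := (poly_sub F (inc v)).

Lemma point_balanced (K : fieldType) (f : {rmorphism polyT F (edge G) -> K}) (a : K) :
    (forall p, in_ideal (map phi (Delta G)) p -> f p = 0) -> a != 0 ->
  balanced [set e | f (pvar F e) == a]%SET.
Proof.
move=> f0 na; apply: level_set_balanced => // w.
have -> : (fun e => f (pvar F e)) = (fun e => (f \o phi) (pvar int e)).
  by apply/funext => e /=; rewrite phi_pvar.
move: w; apply/rmorph_Delta => p pD /=; apply/f0/in_ideal_mem; exact: map_f.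
Qed.

(* P0 need not be contracted from the big ring, but it contains a prime that is. *)
Lemma generic_point (P0 : set A) : prime_ideal P0 ->
    (forall a, in_ideal (map phi (Delta G)) (iota a) -> P0 a) ->
  exists (K : fieldType) (f : {rmorphism polyT F (edge G) -> K}),
    (forall p, in_ideal (map phi (Delta G)) p -> f p = 0) /\
    (forall a, f (iota a) = 0 -> P0 a).
Proof.
move=> prP IP.
(* The multiplicative set to avoid is the image of the complement of [P0]. *)
have [|||||K [f [f0 fS]]] := @field_avoiding (polyT F (edge G))
    (in_ideal (map phi (Delta G))) (fun p => exists2 a, p = iota a & ~ P0 a)
    (in_ideal0 _).
- exact: in_idealD.
- exact: in_idealM.
- by exists 1; [rewrite rmorph1 | case: prP].
- move=> _ _ [a -> na] [b -> nb]; exists (a * b); first by rewrite rmorphM.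
  by case: prP => _ _ _ _ h /h[].
- by move=> p Ip [a ea na]; apply/na/IP; rewrite -ea.
exists K, f; split=> // a fa; apply: contrapT => na.
by have := fS (iota a); rewrite fa eqxx => h; have : false by apply: h; exists a.
Qed.

(** Level sets of different values are disjoint, and each nonzero value at [v] yields a cycle
    through [v] inside its level set; [r] picks one edge for each value. *)
Lemma few_values (K : fieldType) (x : edge G -> K) :
    (forall a, a != 0 -> balanced [set e | x e == a]%SET) ->
  exists d (r : 'I_d -> {e | e \in inc v}), (d <= alpha v)%N /\
    forall e, e \in inc v -> x e = 0 \/ exists j, x e = x (val (r j)).
Proof.
move=> bal; pose s := undup [seq x e | e <- enum (inc v) & x e != 0].
have sP a : a \in s -> exists e, [/\ e \in inc v, x e = a & a != 0].
  rewrite mem_undup => /mapP[e]; rewrite mem_filter mem_enum => /andP[ne ev] ->.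
  by exists e.
have s_nth (i : 'I_(size s)) : s`_i \in s by exact: mem_nth.
have /boolp.choice[r rP] : forall i : 'I_(size s),
    exists r : {e | e \in inc v}, x (val r) = s`_i.
  by move=> i; have [e [ev xe _]] := sP _ (s_nth i); exists (exist _ e ev).
exists (size s), r; split; last first.
  move=> e ev; have [->|ne] := eqVneq (x e) 0; [by left|right].
  have xs : x e \in s by rewrite mem_undup; apply: map_f; rewrite mem_filter ne mem_enum.
  have lt : (index (x e) s < size s)%N by rewrite index_mem.
  by exists (Ordinal lt); rewrite rP nth_index.
have /boolp.choice[S hS] : forall i : 'I_(size s), exists S : {set edge G},
    dicycle_at v S /\ S \subset [set e | x e == s`_i]%SET.
  move=> i; have [e [ev xe na]] := sP _ (s_nth i).
  have [|S] := balanced_dicycle_at (bal _ na) _ ev; first by rewrite inE xe.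
  by exists S.
apply: (@alpha_geq _ _ _ S) => [i|i j ne]; first by case: (hS i).
apply/pred0P => e /=; apply/negP => /andP[ei ej].
have [_ /fintype.subsetP/(_ e ei)] := hS i; have [_ /fintype.subsetP/(_ e ej)] := hS j.
rewrite !inE => /eqP -> /eqP/esym/eqP; rewrite nth_uniq ?undup_uniq //.
by rewrite (inj_eq val_inj) (negPf ne).
Qed.

Variables (P : nat -> set A) (n : nat) (den : set nat).
Hypothesis prP : forall i, (i <= n)%N -> prime_ideal (P i).
Hypothesis ltP : forall i, (i < n)%N -> (P i `<` P i.+1)%classic.
Hypothesis idealP : forall a, in_ideal (map phi (Delta G)) (iota a) -> P 0%N a.
Hypothesis den1 : den 1%N.
Hypothesis denM : forall k l, den k -> den l -> den (k * l)%N.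
Hypothesis denF : forall c : F, exists k (m : int), den k /\ k%:R * c = m%:~R.
Hypothesis den_notin : forall k i, den k -> (i <= n)%N -> ~ P i k%:R.

(** The substitution [sigma] replaces every variable by 0 or by the chosen variable with the same
    value under [f]. As [f] does not see the change, [p] and [sigma p] agree modulo [P 0], and
    [sigma p] involves few variables. *)
Let bounded_generators : exists d (y : 'I_d -> A), (d <= alpha v)%N /\
  forall p, exists u q, [/\ forall i, (i <= n)%N -> ~ P i u,
    int_poly_in y q & P 0%N (u * p - q)].
Proof.
have [K [f [f0 fP]]] := generic_point (prP (leq0n n)) idealP.
have [d [r [le_d hr]]] := few_values (fun a => @point_balanced _ f a f0).
pose y j : A := pvar F (r j); exists d, y; split=> //.
have fy j : f (iota (y j)) = f (pvar F (val (r j))) by rewrite poly_sub_pvar.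
have /boolp.choice[t tP] : forall i, exists t : A, (t = 0 \/ exists j, t = y j) /\
    f (iota 'X_i) = f (iota t).
  move=> i; rewrite pvar_enum_val poly_sub_pvar.
  have [->|[j ->]] := hr _ (valP (enum_val i)).
    by exists 0; split; [left | rewrite !rmorph0].
  by exists (y j); split; [right; exists j | rewrite fy].
pose sigma : {rmorphism A -> A} := comp_mpoly [tuple t i | i < _].
have sigmaX i : sigma 'X_i = t i.
  by rewrite /sigma /= comp_mpolyXU -tnth_nth tnth_mktuple.
have sigmaC c : sigma c%:MP = c%:MP by exact: comp_mpolyC.
have fsigma p : f (iota p) = f (iota (sigma p)).
  apply: (eq_mpoly_rmorph (f := f \o iota) (g := f \o iota \o sigma)) => [c|i].
    by rewrite -[RHS]/(f (iota (sigma c%:MP))) sigmaC.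
  by have [_ e] := tP i; rewrite -[RHS]/(f (iota (sigma 'X_i))) sigmaX -e.
move=> p.
have [i|k [dk hk]] := int_poly_in_mpoly (y := y) (h := sigma) den1 denM denF _ p.
  by rewrite sigmaX; case: (tP i).
exists k%:R, (k%:R * sigma p); split=> [i|//|]; first exact: den_notin.
apply: fP; rewrite -mulrBr (rmorphM iota) (rmorphM f) (rmorphB iota) (rmorphB f).
by rewrite -fsigma subrr mulr0.
Qed.

Lemma length_le : (n <= (alpha v).+1)%N.
Proof.
have [d [y [le_d genP]]] := bounded_generators.
by apply: leq_trans (chain_bound prP ltP genP) _.
Qed.

Lemma length_le_char0 : (forall m, (0 < m)%N -> ~ P n m%:R) -> (n <= alpha v)%N.
Proof.
have [d [y [le_d genP]]] := bounded_generators => char0.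
by apply: leq_trans (chain_bound_char0 prP ltP genP char0) _.
Qed.

End UpperBound.

(** * Annihilators of the homology modules *)

Lemma ann_restr_scal (R R' : comPzRingType) (f : {rmorphism R' -> R})
    (M : lmodType R) (a : R') :
  (a \in ann (restr_scal f M)) <-> forall m : M, f a *: m = 0.
Proof. by split=> [/asboolP h|h]; last apply/asboolP. Qed.

Lemma in_ideal_scale (R : comPzRingType) (M : lmodType R) (s : seq R) (p : R) :
  in_ideal s p -> (forall r, r \in s -> forall m : M, r *: m = 0) ->
  forall m : M, p *: m = 0.
Proof.
move=> sp s0; move: p sp; apply: (in_ideal_min (J := fun p => forall m : M, p *: m = 0)).
- by move=> m; rewrite scale0r.
- by move=> p q hp hq m; rewrite scalerDl hp hq addr0.
- by move=> p q hq m; rewrite -scalerA hq scaler0.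
- exact: s0.
Qed.

Section Annihilators.
Variables (G : digraph) (v : vert G).

Lemma ann_HG0 a :
  (a \in ann (HG0 v)) <-> in_ideal (Delta G) (poly_sub int (inc v) a).
Proof.
have [b0 [deg0 gen]] := koszul_base (idfun : {rmorphism polyT int (edge G) -> _}) (Delta G).
rewrite map_id in gen.
have e := @homology0_ann _ (koszulG G) b0 (poly_sub int (inc v) a) deg0.
exact: iff_trans (ann_restr_scal _ _ _) (iff_trans e (iff_sym (gen _))).
Qed.

Lemma ann_HG0Q a : (a \in ann (HG0Q v)) <->
  in_ideal (map (map_mpoly (intr : int -> rat)) (Delta G)) (poly_sub rat (inc v) a).
Proof.
have [b0 [deg0 gen]] := koszul_base
  (map_mpoly (intr : int -> rat) : {rmorphism polyT int (edge G) -> polyT rat (edge G)})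
  (Delta G).
have e := @homology0_ann _ (koszulGQ G) b0 (poly_sub rat (inc v) a) deg0.
exact: iff_trans (ann_restr_scal _ _ _) (iff_trans e (iff_sym (gen _))).
Qed.

(** The 0-th homology is a summand, which gives one inclusion; conversely its annihilator contracts
    the ideal of [Delta G], which kills all Koszul homology. *)
Lemma ann_HGstar : ann (HGstar v) = ann (HG0 v).
Proof.
have eq_submod (R : pzRingType) (M : lmodType R) (U V : submodule M) :
    submod_pred U = submod_pred V -> U = V.
  case: U V => [p hp] [q hq] /= e; move: hp hq; rewrite e => hp hq.
  by congr Submodule; exact: Prop_irrelevance.
apply: eq_submod; apply/funext => a; apply: asbool_equiv_eq; split=> h.
  move=> m; pose x : total_homology (koszulG G) :=
    [ffun i => match val i as k return homology (koszulG G) k with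
               | 0%N => m | _ => 0 end].
  have := h x => /ffunP/(_ ord0); rewrite !ffunE /= => e.
  exact: e.
have /ann_HG0 Ia : a \in ann (HG0 v) by apply/asboolP.
move=> x; apply/ffunP => i; rewrite ffunE [RHS]ffunE; move: (x i) => m.
apply: in_ideal_scale Ia _ m => p pD n.
exact/null_homotopic_homology/null_homotopic_koszul.
Qed.

End Annihilators.

Lemma fg_Zmodule_fintype (A : zmodType) (I : finType) (g : I -> A) :
  (forall a, exists c : I -> int, a = \sum_i g i *~ c i) -> fg_Zmodule A.
Proof.
move=> gen; exists (map g (enum I)) => a; have [c ->] := gen a.
exists (fun i => nth 0 (map c (enum I)) i).
rewrite -(big_mkord xpredT (fun i => (map g (enum I))`_i *~ nth 0 (map c (enum I)) i)).
rewrite size_map -big_enum; case E : (enum I) => [|i0 r]; first by rewrite big_nil big_geq.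
rewrite (big_nth i0) !big_nat; apply: eq_bigr => i /andP[_ lti].
by rewrite !(nth_map i0).
Qed.

HB.instance Definition _ (A : comPzRingType) (J : submodule A^o) :=
  GRing.isNmodMorphism.Build A (rquot J) (rquot_pi J)
    (conj (rquot_pi0 J) (@rquot_piD A J)).

(** * The two Krull dimensions, and nilpotency without cycles *)

Section Main.
Variables (G : digraph) (v : vert G).
Local Notation acyclic := (forall c : seq (edge G), dicycle c -> v \notin map (@src G) c).

Lemma acyclicP : acyclic <-> alpha v = 0%N.
Proof.
split=> [acyc|a0 c dc]; first by apply/eqP; rewrite -leqn0 -(acyclic_beta acyc) alpha_le_beta.
by apply/negP => vc; have := dicycle_alpha dc vc; rewrite a0.
Qed.

Lemma Kdim_HG0 : Kdim (HG0 v) = (alpha v).+1%:Z%:E.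
Proof.
have [S [cycS disjS]] := alpha_attained v.
have phiX e : (idfun : {rmorphism polyT int (edge G) -> polyT int (edge G)})
  (pvar int e) = pvar int e by [].
apply: krull_dim_eq => [|n]; rewrite prime_chain_rquot.
  (* The constant term modulo 2: its kernel tops the chain of cycle primes, from the last of which
     it is separated by the element 2. *)
  pose ev0 : {rmorphism polyT int {e | e \in inc v} -> 'F_2} := (intr : int -> 'F_2) \o
    (meval (fun=> 0) \o (@label_hom G (alpha v) S int \o poly_sub int (inc v))).
  have ev0E a : ev0 a = ((@label_hom G (alpha v) S int (poly_sub int (inc v) a)).@[fun=> 0])%:~R.
    by [].
  pose P i : set (polyT int {e | e \in inc v}) :=
    if (i <= alpha v)%N then @cycle_prime G v (alpha v) S int i
    else fun a => ev0 a = 0.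
  exists P; split=> [i _|i|i _ a /ann_HG0 Ia]; rewrite /P.
  - by case: leqP => _; [exact: cycle_prime_prime | exact: (prime_ideal_ker ev0)].
  - rewrite ltnS => lei; rewrite lei; case: ltnP => [lt|le].
      exact: cycle_prime_lt.
    have -> : i = alpha v by apply/eqP; rewrite eqn_leq lei.
    split=> [a /cycle_prime_meval h|sub].
      by rewrite ev0E h.
    have : @cycle_prime G v (alpha v) S int (alpha v) 2%:MP.
      apply: sub; rewrite mpolyC_nat rmorph_nat; exact/val_inj.
    by move/cycle_prime_const.
  - rewrite -(map_id (Delta G)) in Ia.
    case: leqP => _; first exact: (cycle_prime_ideal cycS disjS phiX).
    by rewrite ev0E (label_hom_Delta cycS disjS phiX Ia) meval0.
move=> [P [prP ltP JP]].
apply: (@length_le G v int idfun phiX P n (fun k => k = 1%N)) => //.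
- by move=> a; rewrite map_id => Ia; apply: (JP 0%N (leq0n n)); apply/ann_HG0.
- by move=> k l -> ->.
- by move=> c; exists 1%N, c; split=> //; rewrite mul1r intz.
- by move=> k i -> lei; case: (prP i lei).
Qed.

Lemma Kdim_HG0Q : Kdim (HG0Q v) = (alpha v)%:Z%:E.
Proof.
have [S [cycS disjS]] := alpha_attained v.
pose phi : {rmorphism polyT int (edge G) -> polyT rat (edge G)} :=
  map_mpoly (intr : int -> rat).
have phiX e : phi (pvar int e) = pvar rat e by exact: map_mpolyX.
(* Positive integers are units here. They may thus serve as denominators, and the bound for
   characteristic 0 applies. *)
have ndenP (P : set (polyT rat {e | e \in inc v})) k :
    prime_ideal P -> (0 < k)%N -> ~ P k%:R.
  case=> _ _ PM P1 _ k0 /(PM (k%:R^-1)%:MP); rewrite -mpolyC_nat -mpolyCM mulVf //.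
  by rewrite pnatr_eq0 -lt0n.
apply: krull_dim_eq => [|n]; rewrite prime_chain_rquot.
  exists (@cycle_prime G v (alpha v) S rat); split=> [i _|i lti|i _ a /ann_HG0Q].
  - exact: cycle_prime_prime.
  - exact: cycle_prime_lt.
  - exact: (cycle_prime_ideal cycS disjS phiX).
move=> [P [prP ltP JP]].
apply: (@length_le_char0 G v rat phi phiX P n (fun k => 0 < k)%N) => //.
- by move=> a Ia; apply: (JP 0%N (leq0n n)); apply/ann_HG0Q.
- by move=> k l; rewrite muln_gt0 => -> ->.
- move=> c; exists `|denq c|%N, (numq c); rewrite absz_gt0 denq_neq0; split=> //.
  have -> : `|denq c|%N%:R = (denq c)%:~R :> rat.
    by rewrite -[in RHS](gtz0_abs (denq_gt0 c)).
  by rewrite mulrC -numqE.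
- by move=> k i k0 lei; apply: ndenP => //; exact: prP.
- by move=> m m0; apply: ndenP => //; exact: prP.
Qed.

(** If no power of an edge variable lay in the ideal, some point would give that edge a nonzero
    label, and the balanced level set of this label would contain a cycle through [v]. *)
Lemma acyclic_nilpotent : acyclic ->
  exists2 n : nat, (1 <= n)%N &
    forall e, e \in inc v -> in_ideal (Delta G) (pvar int e ^+ n).
Proof.
move=> acyc.
have nil e : exists n, e \in inc v -> in_ideal (Delta G) (pvar int e ^+ n).
  have [ev|nev] := boolP (e \in inc v); last by exists 0%N.
  apply: contrapT => /forallNP nI.
  have [|||||K [f [f0 fS]]] := @field_avoiding (polyT int (edge G))
    (in_ideal (Delta G)) (fun p => exists n, p = pvar int e ^+ n) (in_ideal0 _).
  - exact: in_idealD.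
  - exact: in_idealM.
  - by exists 0%N; rewrite expr0.
  - by move=> _ _ [i ->] [j ->]; exists (i + j)%N; rewrite exprD.
  - by move=> p Ip [n ep]; apply: (nI n); rewrite -ep.
  have fe : f (pvar int e) != 0 by apply: fS; exists 1%N.
  have bal := @point_balanced G int idfun (fun=> erefl) K f _ _ fe.
  have [|||S cycS _] := @balanced_dicycle_at G _ e v (bal _).
  - by rewrite map_id.
  - by rewrite inE.
  - by [].
  by have := acyclic_dicycle_at acyc S; rewrite cycS.
have [N hN] := boolp.choice nil.
(* One exponent for all edges; the successor makes it positive. *)
exists (\max_e N e).+1 => // e ev.
have -> : pvar int e ^+ (\max_e N e).+1 =
    pvar int e ^+ ((\max_e N e).+1 - N e) * pvar int e ^+ N e.
  by rewrite -exprD subnK // leqW // leq_bigmax.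
by apply: in_idealM; exact: hN.
Qed.

End Main.

(** * Finite generation over the integers, and the equivalences *)

(** The finitely many monomials with all exponents below [n] span the quotient. *)
Lemma nilpotent_quot_fg (k n : nat) (J : submodule {mpoly int[k]}^o) :
    (forall i, ('X_i ^+ n : {mpoly int[k]}^o) \in J) -> fg_Zmodule (rquot J).
Proof.
move=> nil; pose A := {mpoly int[k]}; pose box := {ffun 'I_k -> 'I_n}.
have JM (a b : A) : (b : A^o) \in J -> (a * b : A^o) \in J by exact: rpredZ.
pose mon (b : box) : A := 'X_[[multinom (b i : nat) | i < k]].
have nilX (m : 'X_{1..k}) i : (n <= m i)%N -> ('X_[m] : A^o) \in J.
  move=> le_n; rewrite mpolyXE_id (bigD1 i) //= -(subnK le_n) exprD.
  by rewrite -mulrA mulrCA mulrC; apply: JM; exact: nil.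
have gen (p : A) : exists c : box -> int, (p - \sum_b mon b *~ c b : A^o) \in J.
  elim/mpolyind: p => [|z m p _ _ [c IH]].
    by exists (fun=> 0); rewrite big1 ?subrr ?rpred0 // => b _; rewrite mulr0z.
  have [/forallP lt|/forallPn[i]] := boolP [forall i, (m i < n)%N]; last first.
    rewrite -leqNgt => /nilX hm; exists c; rewrite -addrA; apply: rpredD => //.
    by rewrite -mul_mpolyC; exact: JM.
  pose bm : box := [ffun i => Ordinal (lt i)].
  exists (fun b => c b + (if b == bm then z else 0)).
  have -> : z *: 'X_[m] + p - \sum_b mon b *~ (c b + (if b == bm then z else 0)) =
      p - \sum_b mon b *~ c b.
    under eq_bigr do rewrite mulrzDr.
    rewrite big_split /= [X in _ - (_ + X)](bigD1 bm) //= [X in _ + (_ + X)]big1 ?eqxx; last first.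
      by move=> b /negPf ->; rewrite mulr0z.
    have -> : mon bm = 'X_[m].
      by rewrite /mon; congr mpolyX; apply/mnmP => i; rewrite mnmE ffunE.
    rewrite -mul_mpolyC -mulrzl (_ : z%:MP = z%:~R); last first.
      by rewrite -[z in LHS]intz rmorph_int.
    ring.
  exact: IH.
apply: (@fg_Zmodule_fintype _ box (fun b => rquot_pi J (mon b))) => q.
have [c /(rquot_pi_eq0 J)] := gen (rquot_repr q); exists c.
rewrite -{1}(rquot_reprK q); apply/eqP; rewrite -subr_eq0.
have -> : \sum_b rquot_pi J (mon b) *~ c b = rquot_pi J (\sum_b mon b *~ c b).
  by rewrite raddf_sum; apply: eq_bigr => b _; rewrite raddfMz.
by rewrite -raddfB; exact/eqP.
Qed.

Lemma not_fg_quot (A : comNzRingType) (J : submodule A^o)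
    (h : {rmorphism A -> {mpoly int[1]}}) (x : A) :
    (forall a, (a : A^o) \in J -> h a = 0) -> h x = 'X_ord0 ->
  ~ fg_Zmodule (rquot J).
Proof.
move=> h0 hx [s gen]; pose u (q : rquot J) := h (rquot_repr q).
(* [msize] exceeds the degree by one, so the monomial of degree [B] occurs in no combination of the
   images of the generators. *)
pose B := \max_(i < size s) msize (u s`_i)%R.
have [k ek] := gen (rquot_pi J (x ^+ B)).
have : (x ^+ B - \sum_(i < size s) rquot_repr s`_i *~ k i : A^o) \in J.
  apply/rquot_pi_eq0; rewrite (raddfB (rquot_pi J)); apply/eqP; rewrite subr_eq0.
  apply/eqP; apply: (etrans ek); rewrite (raddf_sum (rquot_pi J)).
  apply: eq_bigr => i _; rewrite (raddfMz (rquot_pi J)); congr (_ *~ _).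
  by rewrite [RHS]rquot_reprK.
move=> /h0; rewrite rmorphB rmorphXn hx rmorph_sum.
move/eqP; rewrite subr_eq0 => /eqP /(congr1 (mcoeff (U_(ord0) *+ B)%MM)).
rewrite mpolyXn mcoeffX eqxx raddf_sum big1 // => i _.
rewrite (raddfMz h) raddfMz /= memN_msupp_eq0 ?mul0rz //.
apply/negP => /msize_mdeg_lt; rewrite mdegMn mdeg1 mul1n ltnNge.
by rewrite (leq_bigmax (F := fun i : 'I_(size s) => msize (u s`_i)%R)).
Qed.

Section Finiteness.
Variables (G : digraph) (v : vert G).
Local Notation acyclic := (forall c : seq (edge G), dicycle c -> v \notin map (@src G) c).
Local Notation iota := (poly_sub int (inc v)).

Lemma nilpotent_fg (n : nat) :
    (forall e, e \in inc v -> in_ideal (Delta G) (pvar int e ^+ n)) ->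
  fg_Zmodule (rquot (ann (HG0 v))).
Proof.
move=> nil; apply: (@nilpotent_quot_fg _ n) => i; apply/ann_HG0.
rewrite rmorphXn pvar_enum_val poly_sub_pvar; exact: nil (valP _).
Qed.

Section OneCycle.
Variables (c : seq (edge G)).
Hypotheses (dc : dicycle c) (vc : v \in map (@src G) c).

(* Send the edges of the cycle to the variable of a polynomial ring and the
   other edges to 0. *)
Lemma one_cycle_hom : exists (h : {rmorphism polyT int (edge G) -> {mpoly int[1]}}) e,
  [/\ e \in inc v, h (pvar int e) = 'X_ord0 &
      forall p, in_ideal (Delta G) p -> h p = 0].
Proof.
pose S (i : 'I_1) := [set e in c]%SET.
have cycS i : dicycle_at v (S i) by apply/asboolP; exists c.
have disjS (i j : 'I_1) : i != j -> [disjoint S i & S j] by rewrite !ord1.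
have [e eS ev] := dicycle_at_edge (cycS ord0).
exists (label_hom S int), e; split=> //.
  by rewrite label_hom_pvar (cycle_label_mem disjS _ eS).
move=> p Ip; apply: (@label_hom_Delta G v 1 S cycS disjS int idfun (fun=> erefl)).
by rewrite map_id.
Qed.

Lemma cycle_not_nilpotent n :
  ~ (forall e, e \in inc v -> in_ideal (Delta G) (pvar int e ^+ n)).
Proof.
have [h [e [ev he h0]]] := one_cycle_hom.
move=> /(_ e ev)/h0 /eqP; rewrite rmorphXn he expf_eq0 => /andP[_ /eqP].
by move/(congr1 (mcoeff U_(ord0))); rewrite mcoeffX eqxx mcoeff0.
Qed.

Lemma cycle_not_fg : ~ fg_Zmodule (rquot (ann (HG0 v))).
Proof.
have [h [e [ev he h0]]] := one_cycle_hom.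
apply: (@not_fg_quot _ _ (h \o iota) (pvar int (exist _ e ev))) => [a /ann_HG0/h0 //|].
by rewrite -[LHS]/(h (iota (pvar int _))) poly_sub_pvar.
Qed.

End OneCycle.

Lemma nilpotent_acyclic n :
  (forall e, e \in inc v -> in_ideal (Delta G) (pvar int e ^+ n)) -> acyclic.
Proof. by move=> nil c dc; apply/negP => vc; exact: cycle_not_nilpotent dc vc n nil. Qed.

Lemma fg_acyclic : fg_Zmodule (rquot (ann (HG0 v))) -> acyclic.
Proof. by move=> fg c dc; apply/negP => vc; exact: cycle_not_fg dc vc fg. Qed.

End Finiteness.

Theorem theorem1p13 (G : digraph) (v : vert G) :
  [<-> (forall c : seq (edge G), dicycle c -> v \notin map (@src G) c);
       fg_Zmodule (rquot (ann (HG0 v)));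
       fg_Zmodule (rquot (ann (HGstar v)));
       exists2 n : nat, (1 <= n)%N &
         forall e, e \in inc v -> in_ideal (Delta G) (pvar int e ^+ n);
       Kdim (HG0 v) = 1%:E;
       Kdim (HG0Q v) = 0%:E]
  /\ [/\ ((alpha v)%:Z%:E <= Kdim (HG0Q v))%E,
         (Kdim (HG0Q v) <= Kdim (HG0 v) - 1%:E)%E
       & (Kdim (HG0 v) - 1%:E <= (beta v)%:Z%:E)%E].
Proof.
have eqK : (Kdim (HG0 v) - 1%:E = (alpha v)%:Z%:E)%E.
  by rewrite Kdim_HG0 -EFinB -addn1 PoszD addrK.
split; last by rewrite eqK Kdim_HG0Q !lexx lee_fin lez_nat alpha_le_beta.
(* Each condition implies the next and the last the first; the two dimensions are known exactly, so
   the last three steps pass through [alpha v = 0]. *)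
tfae.
- by move=> acyc; have [n _ nil] := acyclic_nilpotent acyc; exact: nilpotent_fg nil.
- by rewrite ann_HGstar.
- by rewrite ann_HGstar => /fg_acyclic/acyclic_nilpotent.
- by move=> [n _ /nilpotent_acyclic/acyclicP a0]; rewrite Kdim_HG0 a0.
- by rewrite Kdim_HG0Q Kdim_HG0 => -[[->]].
- by rewrite Kdim_HG0Q => -[a0]; apply/acyclicP.
Qed.
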